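(* Let $u\in(0,1)$. With $\chi(a,b,\beta,u)$ the Lyapunov exponent defined in the context: (i) For all $a,b>0$, $\chi(a,b,\beta,u)\to -a$ when $\beta\to 0$, and $\chi(a,b,\beta,u)\to -a$ when $\beta\to+\infty$. (ii) For every $\beta>0$ there exist $a>0$ and $b>0$ such that $\chi(a,b,\beta,u)>0$.
   Context: For real numbers $a>0$, $b>0$ let $$A_0=\begin{pmatrix}-a & b\\ -\frac1b & -a\end{pmatrix},\qquad A_1=\begin{pmatrix}-a & \frac1b\\ -b & -a\end{pmatrix}.$$ For $\beta>0$ and $u\in(0,1)$, let $(I_t)_{t\ge 0}$ be the continuous-time Markov chain on $\{0,1\}$ jumping from $0$ to $1$ at rate $\lambda_0=\beta u$ and from $1$ to $0$ at rate $\lambda_1=\beta(1-u)$. Let $(X_t)_{t\ge0}$ be the continuous $\mathbb{R}^2$-valued process solving $\dot X_t=A_{I_t}X_t$, $X_0=x_0\neq 0$. The Lyapunov exponent is $$\chi(a,b,\beta,u)=\lim_{t\to+\infty}\frac1t\log\|X_t\|\quad\text{almost surely};$$ this limit exists almost surely and is a deterministic constant not depending on the initial condition $(x_0,I_0)$. *)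

(* Defs.v *)
From HB Require Import structures.
From mathcomp Require Import all_boot all_order all_algebra.
From mathcomp Require Import all_classical all_reals all_analysis.

Set Implicit Arguments.
Unset Strict Implicit.
Unset Printing Implicit Defensive.

Import Order.TTheory GRing.Theory Num.Theory.
Import numFieldNormedType.Exports.

Local Open Scope classical_set_scope.
Local Open Scope ring_scope.

(* The state space {0, 1} is bool, with 0 = false and 1 = true. *)

Definition mx2 {R : realType} (x y z t : R) : 'M[R]_2 :=
  \matrix_(i, j) if i == 0 then (if j == 0 then x else y)
                 else (if j == 0 then z else t).

Definition switch_mx {R : realType} (a b : R) (i : bool) : 'M[R]_2 :=
  if i then mx2 (- a) b^-1
                (- b) (- a)
  else mx2 (- a)     b
           (- b^-1)  (- a).

Definition switch_rate {R : realType} (beta u : R) (i : bool) : R :=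
  if i then beta * (1 - u) else beta * u.

Definition enorm {R : realType} (x : 'cV[R]_2) : R :=
  Num.sqrt (\sum_i x i 0 ^+ 2).

(* Jump-chain/holding-time definition of the continuous-time Markov chain on
   {0, 1} that leaves state i at rate lambda i; S n is the time spent in the
   (n+1)-st visited state. On two states the jump chain alternates, so the state
   visited after n jumps is I 0 (+) odd n; given I 0 = i, the holding times are
   independent, S k being exponential of parameter lambda (i (+) odd k). The
   initial law is arbitrary. The divergence of the jump times is automatic (almost
   surely) and only makes explicit that the chain is defined at all times.
   Times are reals; only t >= 0 is constrained. *)
Definition two_state_chain {R : realType} {d : measure_display}
    {T : measurableType d} (P : probability T R) (lambda : bool -> R)
    (I : R -> T -> bool) : Prop :=
  exists S : nat -> T -> R,
    [/\ measurable_fun setT (I 0),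
        (forall n, measurable_fun setT (S n)),
        (forall (n : nat) (i : bool) (B : nat -> set R),
           (forall k, measurable (B k)) ->
           P ((I 0 @^-1` [set i]) `&` \bigcap_(k in `I_n) (S k @^-1` B k)) =
           (P (I 0%R @^-1` [set i]) *
            \prod_(k < n) exponential_prob (lambda (i (+) odd k)) (B k))%E) &
        {ae P, forall w,
           ((\sum_(k < n) S k w) @[n --> \oo] --> +oo) /\
           (forall (n : nat) (t : R),
              \sum_(k < n) S k w <= t < \sum_(k < n.+1) S k w ->
              I t w = I 0 w (+) odd n)}].

(* x' = A_{i(t)} x for t > 0 at which the path i does not jump; together with
   continuity this determines x on [0, +oo[ from x 0 when i has locally finitely
   many jumps. *)
Definition switched_solution {R : realType} (A : bool -> 'M[R]_2)
    (i : R -> bool) (x : R -> 'cV[R]_2) : Prop :=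
  {within `[0, +oo[, continuous x} /\
  (forall t : R, 0 < t -> (\forall s \near t, i s = i t) ->
     is_derive t 1 x (A (i t) *m x t)).

(* l is the almost sure exponential growth rate of the process with parameters
   a, b, beta, u, realised on some probability space, from some initial condition
   (x0, I 0) with x0 <> 0. Since the growth rate depends neither on the realisation
   nor on the initial condition, it is immaterial which one is taken. *)
Definition is_lyapunov_exponent {R : realType} (a b beta u l : R) : Prop :=
  exists (d : measure_display) (T : measurableType d) (P : probability T R)
         (I : R -> T -> bool) (X : R -> T -> 'cV[R]_2) (x0 : 'cV[R]_2),
    [/\ two_state_chain P (switch_rate beta u) I,
        x0 != 0,
        {ae P, forall w, X 0 w = x0 /\
           switched_solution (switch_mx a b) (I ^~ w) (X ^~ w)} &
        {ae P, forall w, (ln (enorm (X t w)) / t) @[t --> +oo] --> l}].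

(* Main.v *)
(** Writing X_t = exp(-at) Y_t reduces everything to a = 0, where both flows are
    rotations along ellipses.  Sample X at the jump times T_n and consider
    quantities U_n ^ r, where U is a positive definite quadratic form depending on
    the state of the chain and r is a real exponent.  If the mean of
    (exp(2 kappa S) U) ^ r contracts by a factor rho < 1 over one sojourn S, from
    any starting vector, then by independence of the sojourns E[U_n ^ r] decays
    geometrically, so by Borel-Cantelli U_n ^ r < 1 eventually, and
    r (chi + a + kappa) <= 0: an upper bound on chi for r > 0 and a lower bound for
    r < 0.  The contraction itself follows from a supersolution F of
    F' <= lambda (F - f), which gives E f(S) <= F(0).
    - beta -> 0: take the conserved form of each flow and r = 1, -1; switching
      costs a bounded factor, so |chi + a| <= K beta.
    - beta -> oo: take the conserved form of the averaged matrix, corrected by a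
      solution of the Poisson equation, and r = 1, -1; then |chi + a| <= C / beta.
    - Positivity: after a sojourn the angle is spread out, and since |sin| ^ (-1/2)
      is integrable the mean of U ^ (-1/4) contracts by O(b ^ (-1/2)). *)
Require Import Defs.
From HB Require Import structures.
From mathcomp Require Import all_boot all_order all_algebra.
From mathcomp Require Import all_classical all_reals all_analysis.
From mathcomp Require Import measurable_realfun ring lra.

Import Order.TTheory GRing.Theory Num.Theory.
Import numFieldNormedType.Exports.

Local Open Scope classical_set_scope.
Local Open Scope ring_scope.

(** * Differentiation of real functions *)

Section real_derivatives.
Context {R : realType}.
Implicit Types (f g : R -> R) (x a b : R).

Lemma is_derive_mul f g x a b : is_derive x (1 : R) f a -> is_derive x (1 : R) g b ->
  is_derive x (1 : R) (fun s => f s * g s) (a * g x + f x * b).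
Proof.
move=> fa gb; rewrite addrC (mulrC a); exact: (is_deriveM fa gb).
Qed.

Lemma is_derive_add f g x a b : is_derive x (1 : R) f a -> is_derive x (1 : R) g b ->
  is_derive x (1 : R) (fun s => f s + g s) (a + b).
Proof. by move=> fa gb; exact: (is_deriveD fa gb). Qed.

Lemma is_derive_sub f g x a b : is_derive x (1 : R) f a -> is_derive x (1 : R) g b ->
  is_derive x (1 : R) (fun s => f s - g s) (a - b).
Proof. by move=> fa gb; exact: (is_deriveB fa gb). Qed.

Lemma is_derive_scale f x a b : is_derive x (1 : R) f a ->
  is_derive x (1 : R) (fun s => b * f s) (b * a).
Proof. by move=> fa; exact: (is_deriveZ b fa). Qed.

Lemma is_derive_sqr f x a : is_derive x (1 : R) f a ->
  is_derive x (1 : R) (fun s => f s ^+ 2) (2 * f x * a).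
Proof.
move=> fa; apply: (is_derive_eq (is_derive_mul _ _ _ _ _ fa fa)).
by ring.
Qed.

Lemma is_derive_expRM x a :
  is_derive x (1 : R) (fun s => expR (a * s)) (a * expR (a * x)).
Proof.
have H := is_derive_scale _ _ _ a (is_derive_id x (1 : R)).
apply: (is_derive_eq (@is_derive1_comp _ expR (fun s => a * s) x _ _ (is_derive_expR _) H)).
by rewrite mulr1 mulrC.
Qed.

Lemma is_derive_powR_comp f x a p : 0 < f x -> is_derive x (1 : R) f a ->
  is_derive x (1 : R) (fun s => f s `^ p) (p * f x `^ (p - 1) * a).
Proof.
move=> f0 fa; have H := is_derive1_powR p f0.
by apply: (is_derive_eq (@is_derive1_comp R (fun y => y `^ p) f x _ _ H fa)).
Qed.

Lemma is_derive_continuous f df : (forall x, is_derive x (1 : R) f (df x)) ->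
  continuous f.
Proof.
move=> fdf x; apply/differentiable_continuous/derivable1_diffP.
by case: (fdf x).
Qed.

End real_derivatives.

(** * Integration against densities and the exponential law *)

Section density.
Import HBNNSimple.

(** For indicators this is the hypothesis on [nu]; linearity gives simple functions, and monotone
    convergence along an approximating sequence gives the rest. *)
Lemma ge0_integral_density {d} {T : measurableType d} {R : realType}
    (mu nu : {measure set T -> \bar R}) (g : T -> R) (f : T -> \bar R) :
  measurable_fun setT g -> (forall x, 0 <= g x) ->
  (forall A, measurable A -> nu A = (\int[mu]_(x in A) (g x)%:E)%E) ->
  measurable_fun setT f -> (forall x, (0 <= f x)%E) ->
  (\int[nu]_x f x = \int[mu]_x (f x * (g x)%:E))%E.
Proof.
move=> mg g0 nuE mf f0.
have mgE : measurable_fun setT (EFin \o g) by exact/measurable_EFinP.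
pose f_ := nnsfun_approx measurableT mf.
transitivity (limn (fun n => \int[nu]_x (f_ n x)%:E)%E).
  rewrite -monotone_convergence//=.
  - by apply: eq_integral => x _; apply/esym/cvg_lim => //; exact: cvg_nnsfun_approx.
  - by move=> n; exact/measurable_EFinP.
  - by move=> n x _; rewrite lee_fin.
  - by move=> x _ m n mn; rewrite lee_fin; exact/lefP/nd_nnsfun_approx.
transitivity (limn (fun n => \int[mu]_x ((f_ n x)%:E * (g x)%:E))%E); last first.
  rewrite -monotone_convergence//=.
  - apply: eq_integral => x _; apply/cvg_lim => //.
    by apply: cvgeZr => //; exact: cvg_nnsfun_approx.
  - by move=> n; apply: emeasurable_funM => //; exact/measurable_EFinP.
  - by move=> n x _; rewrite mule_ge0// lee_fin.
  - move=> x _ m n mn; rewrite lee_wpmul2r ?lee_fin//.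
    exact/lefP/nd_nnsfun_approx.
congr (limn _); apply/funext => n.
under [LHS]eq_integral do rewrite fimfunE -fsumEFin//.
rewrite [LHS]ge0_integral_fsum//; last 2 first.
  - by move=> r; exact/measurable_EFinP/measurableT_comp.
  - by move=> r x _; rewrite EFinM nnfun_muleindic_ge0.
under [RHS]eq_integral.
  move=> x xD; rewrite fimfunE -fsumEFin// muleC ge0_mule_fsumr; last first.
    by move=> r; rewrite EFinM nnfun_muleindic_ge0.
  over.
rewrite [RHS]ge0_integral_fsum//; last 2 first.
  - move=> r; apply: emeasurable_funM => //.
    exact/measurable_EFinP/measurableT_comp.
  - by move=> r x _; rewrite EFinM mule_ge0 ?lee_fin// -lee_fin EFinM nnfun_muleindic_ge0.
apply: eq_fsbigr => r _.
have [r0|r0] := ltP r 0.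
  by rewrite preimage_nnfun0// indic0 !integral0_eq//= => x _; rewrite mulr0 ?mule0.
under eq_integral do rewrite EFinM.
under [RHS]eq_integral do rewrite EFinM muleCA.
have mA : measurable (f_ n @^-1` [set r]) by [].
rewrite !ge0_integralZl//=; last 3 first.
  - by apply: emeasurable_funM => //; exact/measurable_EFinP/measurable_indic.
  - by move=> x _; rewrite mule_ge0 ?lee_fin.
  - exact/measurable_EFinP/measurable_indic.
congr (_ * _)%E; rewrite integral_indic//= setIT nuE// integral_mkcond.
by apply: eq_integral => x _; rewrite patchE indicE; case: ifPn => _;
  rewrite ?mule1 ?mule0.
Qed.

End density.

(** Let [G t] be the integral of [f] against the density up to time [t]. Then
    [G t + F t * expR (- r * t)] has derivative [(dF t - r * (F t - f t)) * expR (- r * t) <= 0], so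
    it stays below its initial value [F 0], and so does [G] since [F >= 0]. *)
Lemma integral_exponential_le {R : realType} (r : R) (f F dF : R -> R)
    (e : probability (measurableTypeR R) R) :
  0 < r -> (e : set R -> \bar R) = exponential_prob r ->
  continuous f -> (forall s, 0 <= f s) -> (forall s, 0 <= F s) ->
  (forall s : R, is_derive s (1 : R) F (dF s)) ->
  (forall s, 0 < s -> dF s <= r * (F s - f s)) ->
  (\int[e]_s (f s)%:E <= (F 0)%:E)%E.
Proof.
move=> r0 eE cf f0 F0 FdF dFf.
pose g s := f s * (r * expR (- r * s)).
have cg : continuous g.
  move=> s; apply: cvgM; first exact: cf.
  apply: cvgM; first exact: cvg_cst.
  apply: continuous_comp; last exact: continuous_expR.
  by apply: cvgM; [exact: cvg_cst|exact: cvg_id].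
have g0 s : 0 <= g s by rewrite mulr_ge0// mulr_ge0 ?expR_ge0// ltW.
have mf : measurable_fun setT f by exact: continuous_measurable_fun.
have -> : (\int[e]_s (f s)%:E = \int[lebesgue_measure]_(s in `[0%R, +oo[) (g s)%:E)%E.
  rewrite (ge0_integral_density lebesgue_measure _ (exponential_pdf r))//; last 4 first.
  - exact: measurable_exponential_pdf.
  - by move=> x; apply: exponential_pdf_ge0; exact: ltW.
  - by move=> A mA; exact: (congr1 (@^~ A) eE).
  - exact/measurable_EFinP.
  rewrite [RHS]integral_mkcond; apply: eq_integral => s _.
  rewrite patchE /exponential_pdf patchE; case: ifPn => _; last by rewrite mule0.
  by rewrite -EFinM.
(* The integral over the half-line is a supremum of integrals over bounded segments starting at
   0. *)
rewrite ge0_integral_ereal_sup//; last exact: continuous_measurable_fun.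
apply: ge_ereal_sup => _ [n _ <-].
have ig : lebesgue_measure.-integrable `[0, n.+1%:R] (EFin \o g).
  apply: continuous_compact_integrable; first exact: segment_compact.
  exact: continuous_subspaceT.
pose G t := parameterized_integral lebesgue_measure 0 t g.
pose h t := F t * expR (- r * t).
have G0 : G 0 = 0 by rewrite /G /parameterized_integral set_itv1 Rintegral_set1.
suff : G n.+1%:R + h n.+1%:R <= G 0 + h 0.
  rewrite G0 add0r /h mulr0 expR0 mulr1 => Gh.
  have -> : (\int[lebesgue_measure]_(s in `[0%R, n.+1%:R]) (g s)%:E = (G n.+1%:R)%:E)%E.
    rewrite /G /parameterized_integral /Rintegral fineK//.
    exact: integrable_fin_num.
  by rewrite lee_fin; apply: le_trans Gh; rewrite lerDl mulr_ge0// expR_ge0.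
have dGh (t : R) : t \in `]0, n.+1%:R[ ->
    is_derive t (1 : R) (G \+ h) (g t + (dF t - r * F t) * expR (- r * t)).
  rewrite in_itv/= => /andP[t0 tn].
  have [Gd GE] := continuous_FTC1_closed tn ig t0 (cg t).
  have GD : is_derive t (1 : R) G (g t) by apply: DeriveDef; [exact: Gd|rewrite -derive1E].
  have H := is_derive_mul _ _ _ _ _ (FdF t) (is_derive_expRM t (- r)).
  apply: (is_derive_eq (is_derive_add _ _ _ _ _ GD H)).
  by ring.
have cGh : {within `[0, n.+1%:R], continuous (G \+ h)}.
  have cG : {within `[0, n.+1%:R], continuous G}.
    exact: parameterized_integral_continuous.
  have ch : {within `[0, n.+1%:R], continuous h}.
    apply: continuous_subspaceT.
    apply: (is_derive_continuous _ (fun t => dF t * expR (- r * t) +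
      F t * (- r * expR (- r * t)))) => t.
    exact: is_derive_mul (FdF t) (is_derive_expRM t (- r)).
  by move=> z; apply: cvgD; [exact: cG|exact: ch].
have n0 : (0 : R) < n.+1%:R by [].
have [c] := MVT n0 dGh cGh.
rewrite in_itv/= => /andP[c0 _] /(congr1 (fun z => z <= 0)).
rewrite subr_le0 => ->; rewrite subr0 pmulr_lle0//.
rewrite /g.
have := dFf c c0; have := expR_gt0 (- r * c).
set E := expR _; nra.
Qed.

(** * Random recursions driven by independent variables *)

Section law.
Context {d d'} {T : measurableType d} {E : measurableType d'} {R : realType}.
Variable mu : {finite_measure set T -> \bar R}.

(** The law of [X] restricted to the event [D], not normalised: its total mass is [mu D]. The proofs
    [mD] and [mX] are arguments so that inference can attach the measure structure. *)
Definition law {D : set T} {X : T -> E} (mD : measurable D)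
  (mX : measurable_fun setT X) (A : set E) := mu (D `&` X @^-1` A).

Variables (D : set T) (X : T -> E).
Hypotheses (mD : measurable D) (mX : measurable_fun setT X).

Let mpre A : measurable A -> measurable (D `&` X @^-1` A).
Proof. by move=> mA; apply: measurableI => //; rewrite -[X in measurable X]setTI; exact: mX. Qed.

Let law0 : law mD mX set0 = 0%E.
Proof. by rewrite /law preimage_set0 setI0 measure0. Qed.

Let law_ge0 A : (0 <= law mD mX A)%E.
Proof. exact: measure_ge0. Qed.

Let law_sigma_additive : semi_sigma_additive (law mD mX).
Proof.
move=> F mF tF mUF; rewrite /law preimage_bigcup setI_bigcupr.
apply: measure_semi_sigma_additive.
- by move=> n; exact: mpre.
- apply/trivIset_setIl/trivIsetP => i j _ _ ij; rewrite -preimage_setI.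
  by move/trivIsetP : tF => /(_ _ _ Logic.I Logic.I ij) ->; rewrite preimage_set0.
- by rewrite -setI_bigcupr -preimage_bigcup; exact: mpre.
Qed.

HB.instance Definition _ := isMeasure.Build _ _ _ (law mD mX)
  law0 law_ge0 law_sigma_additive.

Let law_fin : fin_num_fun (law mD mX).
Proof. by move=> A mA; exact/fin_num_measure/mpre. Qed.

HB.instance Definition _ := Measure_isFinite.Build _ _ _ (law mD mX) law_fin.

End law.

Section chain.
Context {d dE dF} {T : measurableType d} {E : measurableType dE}
  {F : measurableType dF} {R : realType}.
Variables (mu : {finite_measure set T -> \bar R}) (D : set T)
  (S : nat -> T -> F) (e : nat -> probability F R)
  (phi : nat -> E * F -> E) (y0 : E).

Fixpoint chain n (w : T) : E :=
  if n is m.+1 then phi m (chain m w, S m w) else y0.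

Hypotheses (mD : measurable D) (mS : forall n, measurable_fun setT (S n))
  (mphi : forall n, measurable_fun setT (phi n)).
Hypothesis SE : forall n (B : nat -> set F), (forall k, measurable (B k)) ->
  mu (D `&` \bigcap_(k in `I_n) (S k @^-1` B k)) =
  (mu D * \prod_(k < n) e k (B k))%E.

Lemma measurable_chain n : measurable_fun setT (chain n).
Proof.
elim: n => [|n IHn]; first exact: measurable_cst.
by apply: (measurableT_comp (mphi n)); exact: measurable_fun_pair.
Qed.

Let mpre {dU} {U : measurableType dU} (X : T -> U) (A : set U) :
  measurable_fun setT X -> measurable A -> measurable (X @^-1` A).
Proof. by move=> mX mA; rewrite -[X in measurable X]setTI; exact: mX. Qed.

Let cylinder n m (B : nat -> set F) :=
  \bigcap_(k in `I_m) (S (n + k) @^-1` B k).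

Let cylinderS n m B :
  cylinder n m.+1 B = S n @^-1` B 0%N `&` cylinder n.+1 m (B \o succn).
Proof.
apply/seteqP; split => w.
  move=> H; split; first by have := H 0%N isT; rewrite addn0.
  by move=> k /= km; have := H k.+1 km; rewrite addnS.
by move=> [H0 H] [|k] /= km; rewrite ?addn0// addnS; exact: H.
Qed.

Let measurable_cylinder n m B : (forall k, measurable (B k)) ->
  measurable (cylinder n m B).
Proof.
by move=> mB; apply: bigcap_measurableType => k _; exact: mpre.
Qed.

Let measurable_step n : measurable_fun setT (fun w => (chain n w, S n w)).
Proof. by apply: measurable_fun_pair; [exact: measurable_chain|exact: mS]. Qed.

(** The invariant of the recursion: on [D], the state at time [n] is independent of the driving
    variables from [S n] on. The length [m] is quantified inside because passing to [n.+1] consumes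
    one side of the cylinder. *)
Let future_indep n := forall m (A : set E) B, measurable A ->
  (forall k, measurable (B k)) ->
  mu (D `&` chain n @^-1` A `&` cylinder n m B) =
  (mu (D `&` chain n @^-1` A) * \prod_(k < m) e (n + k)%N (B k))%E.

(** For fixed [B], both sides are measures in [Z]. They agree on rectangles by the invariant at
    length [m.+1], and rectangles determine a product measure. *)
Let future_indep_joint n : future_indep n ->
  forall m B Z, (forall k, measurable (B k)) -> measurable Z ->
  mu (D `&` (fun w => (chain n w, S n w)) @^-1` Z `&` cylinder n.+1 m B) =
  ((law mu mD (measurable_chain n) \x e n) Z *
   \prod_(k < m) e (n.+1 + k)%N (B k))%E.
Proof.
move=> IHn m B Z mB mZ.
set C := cylinder n.+1 m B.
have mC : measurable C by exact: measurable_cylinder.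
have mDC : measurable (D `&` C) by exact: measurableI.
(* The probability of the later cylinder, taken as a real number so that it can scale the second
   factor of the product measure. *)
pose q := \prod_(k < m) fine (e (n.+1 + k)%N (B k)).
have q0 : 0 <= q by apply: prodr_ge0 => k _; exact: fine_ge0.
have qE : q%:E = (\prod_(k < m) e (n.+1 + k)%N (B k))%E.
  rewrite /q -prodEFin; apply: eq_bigr => k _.
  by rewrite fineK//; exact: fin_num_measure.
rewrite -qE.
have joint A0 B0 : measurable A0 -> measurable B0 ->
    mu (D `&` C `&` ((fun w => (chain n w, S n w)) @^-1` (A0 `*` B0))) =
    (mu (D `&` chain n @^-1` A0) * (e n B0 * q%:E))%E.
  move=> mA0 mB0; pose B' k := if k is k'.+1 then B k' else B0.
  have mB' k : measurable (B' k) by case: k.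
  have := IHn m.+1 A0 B' mA0 mB'.
  rewrite big_ord_recl /= addn0 cylinderS.
  under eq_bigr do rewrite /bump/= add1n addnS -addSn.
  rewrite -qE => <-; congr (mu _).
  by apply/seteqP; split => w /=; rewrite /C; tauto.
pose m1 := law mu mD (measurable_chain n).
have prodE : forall Z, measurable Z ->
    (m1 \x mscale (NngNum q0) (e n))%E Z = law mu mDC (measurable_step n) Z.
  apply: product_measure_unique => A0 B0 mA0 mB0.
  apply: (eq_trans (joint _ _ mA0 mB0)).
  by rewrite /mscale/= /m1 /law (muleC (e n B0)).
transitivity (law mu mDC (measurable_step n) Z).
  by congr (mu _); apply/seteqP; split => w /=; rewrite /C; tauto.
apply: (eq_trans (esym (prodE _ mZ))).
rewrite /product_measure1/= muleC -ge0_integralZl//=.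
exact: measurable_fun_xsection.
Qed.

(** At time 0 the state is the constant [y0], so the claim is [SE]. For the step, an event on
    [chain n.+1] is an event on [(chain n, S n)]; the joint formula is applied with the given
    cylinder and with an empty one, and the two are compared. *)
Let chain_future_indep n : future_indep n.
Proof.
elim: n => [|n IHn] m A B mA mB /=.
  have [yA|yA] := pselect (A y0).
    by rewrite (_ : _ @^-1` A = setT) ?setIT; [exact: SE|by apply/seteqP; split].
  rewrite (_ : _ @^-1` A = set0) ?setI0 ?set0I ?measure0 ?mul0e//.
  by apply/seteqP; split.
have mphiA : measurable (phi n @^-1` A).
  by rewrite -[X in measurable X]setTI; exact: mphi.
rewrite [LHS](future_indep_joint _ IHn m B _ mB mphiA).
have := future_indep_joint _ IHn 0%N B _ mB mphiA.
rewrite big_ord0 mule1 /cylinder (_ : \bigcap_(k in `I_0) _ = setT) ?setIT => [<-//|].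
by apply/seteqP; split.
Qed.

(** The joint law of [(chain n, S n)] on [D] is a product, the law of [chain n.+1] is its
    pushforward by [phi n], and Tonelli integrates the new variable first. *)
Lemma ge0_integral_chainS n (g : E -> \bar R) : measurable_fun setT g ->
  (forall y, (0 <= g y)%E) ->
  (\int[law mu mD (measurable_chain n.+1)]_y g y =
   \int[law mu mD (measurable_chain n)]_y \int[e n]_s g (phi n (y, s)))%E.
Proof.
move=> mg g0.
have mgphi : measurable_fun setT (g \o phi n) by exact: measurableT_comp.
rewrite -(fubini_tonelli1 (g \o phi n))//; last by move=> x; exact: g0.
rewrite (eq_measure_integral (pushforward
  (law mu mD (measurable_chain n) \x e n)%E (phi n))); last first.
  move=> A mA _.
  have mphiA : measurable (phi n @^-1` A).
    by rewrite -[X in measurable X]setTI; exact: mphi.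
  have := future_indep_joint n (chain_future_indep n) 0%N (fun=> setT) _
    (fun=> measurableT) mphiA.
  rewrite big_ord0 mule1 /cylinder (_ : \bigcap_(k in `I_0) _ = setT) ?setIT//.
  by apply/seteqP; split.
by rewrite ge0_integral_pushforward//= preimage_setT.
Qed.

End chain.

(** By the step hypothesis the integral of [V n] over [D] is at most [rho ^+ n] times the initial
    one. Markov's inequality makes the masses of the events [V n >= 1] summable, and Borel-Cantelli
    concludes. *)
Lemma chain_eventually_lt1 {d dE dF} {T : measurableType d}
    {E : measurableType dE} {F : measurableType dF} {R : realType}
    (mu : {finite_measure set T -> \bar R}) (D : set T)
    (S : nat -> T -> F) (e : nat -> probability F R)
    (phi : nat -> E * F -> E) (y0 : E) (V : nat -> E -> R) (rho : R) :
  measurable D -> (forall n, measurable_fun setT (S n)) ->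
  (forall n, measurable_fun setT (phi n)) ->
  (forall n (B : nat -> set F), (forall k, measurable (B k)) ->
    mu (D `&` \bigcap_(k in `I_n) (S k @^-1` B k)) =
    (mu D * \prod_(k < n) e k (B k))%E) ->
  (forall n, measurable_fun setT (V n)) -> (forall n y, 0 <= V n y) ->
  0 <= rho < 1 ->
  (forall n y, (\int[e n]_s (V n.+1 (phi n (y, s)))%:E <= (rho * V n y)%:E)%E) ->
  {ae mu, forall w, D w -> \forall n \near \oo, V n (chain S phi y0 n w) < 1}.
Proof.
move=> mD mS mphi SE mV V0 /andP[rho0 rho1] step.
have mVE n : measurable_fun setT (EFin \o V n) by exact/measurable_EFinP.
pose Q n := law mu mD (measurable_chain S phi y0 mS mphi n).
have intV n : (\int[Q n]_y (V n y)%:E <= (rho ^+ n * (V 0%N y0 * fine (mu D)))%:E)%E.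
  elim: n => [|n IHn].
    rewrite expr0 mul1r.
    (* The initial state is deterministic: its restricted law is the Dirac mass at [y0] with weight
       [mu D]. *)
    have QE A : measurable A -> A `<=` setT ->
        Q 0%N A = mscale (NngNum (fine_ge0 (measure_ge0 mu D))) (dirac y0) A.
      move=> mA _.
      change (mu (D `&` (fun=> y0) @^-1` A) = ((fine (mu D))%:E * \d_y0 A)%E).
      rewrite fineK ?fin_num_measure// diracE.
      case: (boolP (y0 \in A)); rewrite ?inE ?notin_setE => yA.
        by rewrite mule1 (_ : _ @^-1` A = setT) ?setIT//; apply/seteqP; split.
      rewrite mule0 (_ : _ @^-1` A = set0) ?setI0 ?measure0//.
      by apply/seteqP; split.
    rewrite (eq_measure_integral _ QE) ge0_integral_mscale//=; last 2 first.
    - exact: mVE.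
    - by move=> y _; rewrite lee_fin.
    rewrite [X in (_ * X)%E](_ : _ = (V 0%N y0)%:E).
      by rewrite -EFinM mulrC.
    by rewrite (integral_dirac y0 measurableT (mVE 0%N)) diracT mul1e.
  rewrite (ge0_integral_chainS _ _ _ e)//; last 2 first.
  - exact: mVE.
  - by move=> y; rewrite lee_fin.
  apply: (@le_trans _ _ (\int[Q n]_y (rho%:E * (V n y)%:E))%E).
    apply: ge0_le_integral => //.
    - by move=> y _; apply: integral_ge0 => s _; rewrite lee_fin.
    - apply: (measurable_fun_fubini_tonelli_F (EFin \o (V n.+1 \o phi n))).
        by apply: measurableT_comp => //; exact: measurableT_comp.
      by move=> z; rewrite lee_fin; exact: V0.
    - exact/measurable_funeM/mVE.
  rewrite ge0_integralZl//; last 2 first.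
  - exact: mVE.
  - by move=> y _; rewrite lee_fin.
  rewrite exprS -mulrA EFinM; apply: lee_wpmul2l => //; exact: IHn.
have mV1 n : measurable [set y | 1 <= V n y].
  rewrite (_ : [set _ | _] = setT `&` V n @^-1` `[1, +oo[); first exact: mV.
  by apply/seteqP; split => y /=; rewrite in_itv/= andbT// => -[].
pose G n := D `&` chain S phi y0 n @^-1` [set y | 1 <= V n y].
have mG n : measurable (G n).
  apply: measurableI => //; rewrite -[X in measurable X]setTI.
  exact: measurable_chain.
have GV n : (mu (G n) <= (rho ^+ n * (V 0%N y0 * fine (mu D)))%:E)%E.
  apply: le_trans (intV n).
  apply: (@le_trans _ _ (\int[Q n]_y (\1_[set y | 1 <= V n y] y)%:E)%E).
    by rewrite integral_indic// setIT.
  apply: ge0_le_integral => //.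
  - by apply/measurable_EFinP; exact: measurable_indic.
  - exact: mVE.
  - move=> y _; rewrite indicE lee_fin;
    case: (boolP (y \in _)) => [|_]; [by rewrite inE|exact: V0].
have G0 : mu (lim_sup_set G) = 0%E.
  apply: lim_sup_set_cvg0 => //.
  pose K := V 0%N y0 * fine (mu D).
  apply: (@le_lt_trans _ _ (\sum_(n <oo) (geometric K rho n)%:E)%E).
    apply: lee_nneseries => [//|k _]; rewrite /geometric/= mulrC; exact: GV.
  rewrite (_ : (fun n => _) = EFin \o series (geometric K rho)).
    rewrite EFin_lim ?ltry//.
    by apply: is_cvg_geometric_series; rewrite ger0_norm.
  by apply/funext => n; rewrite /= sumEFin.
exists (lim_sup_set G); split => //.
  apply: bigcap_measurable => // k _.
  by apply: bigcup_measurable => j _; exact: mG.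
move=> w /= H n _; apply: contrapT => Hn; apply: H => Dw.
exists n => // k /= nk; rewrite ltNge; apply/negP => Vk.
by apply: Hn; exists k.
Qed.

(** * Growth along one trajectory *)

Lemma eq_derive0 {R : realType} (f : R -> R) (s0 s1 : R) : s0 <= s1 ->
  {within `[s0, s1], continuous f} ->
  (forall t : R, s0 < t < s1 -> is_derive t (1 : R) f 0) -> f s1 = f s0.
Proof.
move=> s01 cf df.
have dfi (t : R) : t \in `]s0, s1[ -> is_derive t (1 : R) f 0.
  by rewrite in_itv/=; exact: df.
have [c _] := MVT_segment s01 dfi cf.
by rewrite mul0r => /eqP; rewrite subr_eq0 => /eqP.
Qed.

(* The flow of [[kappa, w], [- 1 / w, kappa]]. *)
Definition rotation {R : realType} (w kappa : R) (y : R * R) (s : R) : R * R :=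
  (expR (kappa * s) * (cos s * y.1 + w * sin s * y.2),
   expR (kappa * s) * (cos s * y.2 - w^-1 * sin s * y.1)).

(** Pulling the solution back by the inverse flow gives a function with zero derivative, hence
    constant; the conclusion follows by inverting. The equation is asked only on the open interval,
    since it may fail at jump times. *)
Lemma rotation_solution {R : realType} (a w s0 s1 : R) (x1 x2 : R -> R) :
  w != 0 -> s0 <= s1 ->
  {within `[s0, s1], continuous x1} -> {within `[s0, s1], continuous x2} ->
  (forall t : R, s0 < t < s1 ->
    is_derive t (1 : R) x1 (- a * x1 t + w * x2 t)) ->
  (forall t : R, s0 < t < s1 ->
    is_derive t (1 : R) x2 (- w^-1 * x1 t - a * x2 t)) ->
  (x1 s1, x2 s1) = rotation w (- a) (x1 s0, x2 s0) (s1 - s0).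
Proof.
move=> w0 s01 c1 c2 d1 d2.
have ds (t : R) : is_derive t (1 : R) (fun t => t - s0) 1.
  apply: (is_derive_eq (is_derive_sub _ _ _ _ _ (is_derive_id t (1 : R))
    (is_derive_cst s0 t (1 : R)))).
  by rewrite subr0.
have dc (t : R) : is_derive t (1 : R) (fun t => cos (t - s0)) (- sin (t - s0)).
  apply: (is_derive_eq (@is_derive1_comp R cos (fun t => t - s0) t _ _ (is_derive_cos _) (ds t))).
  by rewrite mulr1.
have dn (t : R) : is_derive t (1 : R) (fun t => sin (t - s0)) (cos (t - s0)).
  apply: (is_derive_eq (@is_derive1_comp R sin (fun t => t - s0) t _ _ (is_derive_sin _) (ds t))).
  by rewrite mulr1.
have de (t : R) : is_derive t (1 : R) (fun t => expR (a * (t - s0))) (a * expR (a * (t - s0))).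
  apply: (is_derive_eq (@is_derive1_comp R (fun z => expR (a * z)) (fun t => t - s0) t _ _
    (is_derive_expRM _ _) (ds t))).
  by rewrite mulr1.
have within (g dg : R -> R) : (forall t : R, is_derive t (1 : R) g (dg t)) ->
    {within `[s0, s1], continuous g}.
  by move=> H; apply: continuous_subspaceT; exact: (is_derive_continuous _ _ H).
have cc := within _ _ dc; have cn := within _ _ dn; have ce := within _ _ de.
(* [Z1] and [Z2] are the two coordinates of the pulled-back solution, compared at [s1] and [s0]. *)
have Z1 : expR (a * (s1 - s0)) * (cos (s1 - s0) * x1 s1 - w * (sin (s1 - s0) * x2 s1)) = x1 s0.
  have cZ : {within `[s0, s1], continuous (fun t => expR (a * (t - s0)) *
      (cos (t - s0) * x1 t - w * (sin (t - s0) * x2 t)))}.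
    move=> z; apply: cvgM; first exact: ce.
    apply: cvgB; first by apply: cvgM; [exact: cc|exact: c1].
    by apply: cvgM; [exact: cvg_cst|apply: cvgM; [exact: cn|exact: c2]].
  have dZ (t : R) : s0 < t < s1 -> is_derive t (1 : R) (fun t => expR (a * (t - s0)) *
      (cos (t - s0) * x1 t - w * (sin (t - s0) * x2 t))) 0.
    move=> tI; apply: (is_derive_eq (is_derive_mul _ _ _ _ _ (de t)
      (is_derive_sub _ _ _ _ _ (is_derive_mul _ _ _ _ _ (dc t) (d1 t tI))
        (is_derive_scale _ _ _ w (is_derive_mul _ _ _ _ _ (dn t) (d2 t tI)))))).
    by field.
  apply: etrans (eq_derive0 _ _ _ s01 cZ dZ) _.
  by rewrite subrr mulr0 expR0 cos0 sin0 !mul1r mul0r mulr0 subr0.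
have Z2 : expR (a * (s1 - s0)) * (cos (s1 - s0) * x2 s1 + w^-1 * (sin (s1 - s0) * x1 s1)) = x2 s0.
  have cZ : {within `[s0, s1], continuous (fun t => expR (a * (t - s0)) *
      (cos (t - s0) * x2 t + w^-1 * (sin (t - s0) * x1 t)))}.
    move=> z; apply: cvgM; first exact: ce.
    apply: cvgD; first by apply: cvgM; [exact: cc|exact: c2].
    by apply: cvgM; [exact: cvg_cst|apply: cvgM; [exact: cn|exact: c1]].
  have dZ (t : R) : s0 < t < s1 -> is_derive t (1 : R) (fun t => expR (a * (t - s0)) *
      (cos (t - s0) * x2 t + w^-1 * (sin (t - s0) * x1 t))) 0.
    move=> tI; apply: (is_derive_eq (is_derive_mul _ _ _ _ _ (de t)
      (is_derive_add _ _ _ _ _ (is_derive_mul _ _ _ _ _ (dc t) (d2 t tI))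
        (is_derive_scale _ _ _ w^-1 (is_derive_mul _ _ _ _ _ (dn t) (d1 t tI)))))).
    by field.
  apply: etrans (eq_derive0 _ _ _ s01 cZ dZ) _.
  by rewrite subrr mulr0 expR0 cos0 sin0 !mul1r mul0r mulr0 addr0.
rewrite /rotation/= -Z1 -Z2 mulNr expRN.
have := cos2Dsin2 (s1 - s0).
move: (cos _) (sin _) (expR _) (expR_gt0 (a * (s1 - s0))) => C N E E0 CN.
by congr (_, _); rewrite -[LHS]mul1r -CN; field; rewrite w0 gt_eqF.
Qed.

Definition vec {R : realType} (x : 'cV[R]_2) : R * R := (x 0 0, x 1 0).

(** The [w] for which [switch_mx a b i] is [[[- a, w], [- 1 / w, - a]]]: the axis ratio of the
    ellipses traced by its flow once the scalar part is removed. *)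
Definition aspect {R : realType} (b : R) (i : bool) : R := if i then b^-1 else b.

Lemma is_derive_entry {R : realType} {m n : nat} (x : R -> 'M[R]_(m, n)) (t : R)
    (dx : 'M[R]_(m, n)) i j :
  is_derive t (1 : R) x dx -> is_derive t (1 : R) (fun s => x s i j) (dx i j).
Proof.
move=> [dxt <-]; apply: DeriveDef; first by move/derivable_mxP : dxt.
by rewrite derive_mx// mxE.
Qed.

Lemma switch_mxE {R : realType} (a b : R) i (x : 'cV[R]_2) :
  (switch_mx a b i *m x) 0 0 = - a * x 0 0 + aspect b i * x 1 0 /\
  (switch_mx a b i *m x) 1 0 = - (aspect b i)^-1 * x 0 0 - a * x 1 0.
Proof.
rewrite !mxE !big_ord_recl !big_ord0 /switch_mx /aspect /mx2.
have -> : lift ord0 ord0 = 1 :> 'I_2 by exact/val_inj.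
by case: i; rewrite !mxE/= ?invrK ?addr0 ?mulNr.
Qed.

Section switched_path.
Context {R : realType}.
Variables (a b kappa : R) (i0 : bool) (S : nat -> R) (iota : R -> bool)
  (x : R -> 'cV[R]_2) (Y : nat -> R * R).
Hypotheses (b0 : b != 0) (S0 : forall n, 0 <= S n).
Hypothesis iotaE : forall (n : nat) (t : R),
  \sum_(k < n) S k <= t < \sum_(k < n.+1) S k -> iota t = i0 (+) odd n.
Hypothesis sol : switched_solution (switch_mx a b) iota x.
Hypotheses (Y0 : Y 0%N = vec (x 0))
  (YS : forall n, Y n.+1 = rotation (aspect b (i0 (+) odd n)) kappa (Y n) (S n)).

Let T n := \sum_(k < n) S k.

Let T_ge0 n : 0 <= T n. Proof. exact: sumr_ge0. Qed.

Let TS n : T n.+1 = T n + S n. Proof. exact: big_ord_recr. Qed.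

Let aspect_neq0 i : aspect b i != 0.
Proof. by case: i; rewrite //= invr_eq0. Qed.

(** Strictly between two jump times the path of the chain is locally constant, so the equation holds
    there; continuity carries the explicit flow up to both ends. *)
Lemma vec_step n :
  vec (x (T n.+1)) = rotation (aspect b (i0 (+) odd n)) (- a) (vec (x (T n))) (S n).
Proof.
have TT : T n <= T n.+1 by rewrite TS lerDl.
have cont i : {within `[T n, T n.+1], continuous (fun t => x t i 0)}.
  have [cx _] := sol.
  have {}cx : {within `[T n, T n.+1], continuous x}.
    apply: continuous_subspaceW cx => t /=; rewrite !in_itv/= andbT => /andP[+ _].
    exact: le_trans.
  move=> z; apply: (@cvg_comp _ _ _ x (fun M : 'cV[R]_2 => M i 0) _ _ _ (cx z)).
  exact: coord_continuous.
have der t : T n < t < T n.+1 ->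
    is_derive t (1 : R) x (switch_mx a b (i0 (+) odd n) *m x t).
  move=> /andP[Tt tT]; have [_ dx] := sol.
  have iotat : iota t = i0 (+) odd n by apply: iotaE; rewrite tT ltW.
  rewrite -iotat; apply: dx; first exact: le_lt_trans Tt.
  have tI : t \in `]T n, T n.+1[ by rewrite in_itv/= Tt.
  near=> s; rewrite iotat; apply: iotaE.
  have : s \in `]T n, T n.+1[ by near: s; exact: near_in_itvoo.
  by rewrite in_itv/= => /andP[/ltW -> ->].
have := rotation_solution a _ _ _ _ _ (aspect_neq0 (i0 (+) odd n)) TT (cont 0) (cont 1).
have -> : T n.+1 - T n = S n by rewrite TS addrAC subrr add0r.
apply => t tI.
  have := is_derive_entry _ _ _ 0 0 (der t tI).
  by rewrite (switch_mxE _ _ _ _).1.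
have := is_derive_entry _ _ _ 1 0 (der t tI).
by rewrite (switch_mxE _ _ _ _).2.
Unshelve. all: by end_near. Qed.

(** Changing the scalar part of the generator only multiplies the flow by an exponential. The
    recursion [Y] may thus be run with any rate [kappa] in place of [- a], which leaves [kappa] free
    to be tuned. *)
Lemma vec_jump_times n : vec (x (T n)) =
  (expR (- (a + kappa) * T n) * (Y n).1, expR (- (a + kappa) * T n) * (Y n).2).
Proof.
elim: n => [|n IHn]; first by rewrite /T big_ord0 mulr0 expR0 !mul1r Y0; case: vec.
rewrite vec_step IHn YS TS /rotation/=.
have -> : expR (- (a + kappa) * (T n + S n)) =
    expR (- (a + kappa) * T n) * expR (- (a + kappa) * S n).
  by rewrite -expRD mulrDr.
have -> : expR (- a * S n) = expR (- (a + kappa) * S n) * expR (kappa * S n).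
  by rewrite -expRD; congr expR; ring.
by congr (_, _); ring.
Qed.

End switched_path.

(** * Norms, ellipses and the growth rate read at jump times *)

Definition sqnorm {R : realType} (y : R * R) : R := y.1 ^+ 2 + y.2 ^+ 2.

Lemma sqnorm_ge0 {R : realType} (y : R * R) : 0 <= sqnorm y.
Proof. by rewrite addr_ge0// sqr_ge0. Qed.

Lemma sqnorm_eq0 {R : realType} (y : R * R) : (sqnorm y == 0) = (y == 0).
Proof.
by case: y => y1 y2; rewrite /sqnorm paddr_eq0 ?sqr_ge0//= !sqrf_eq0.
Qed.

Lemma sqnorm_vec {R : realType} (x : 'cV[R]_2) : enorm x = Num.sqrt (sqnorm (vec x)).
Proof.
rewrite /enorm !big_ord_recl big_ord0 addr0 /sqnorm /vec.
by have -> : lift ord0 ord0 = 1 :> 'I_2 by exact/val_inj.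
Qed.

Definition form {R : realType} (w : R) (y : R * R) : R := y.1 ^+ 2 + w ^+ 2 * y.2 ^+ 2.

Lemma form_rotation {R : realType} (w kappa s : R) (y : R * R) : w != 0 ->
  form w (rotation w kappa y s) = expR (2 * kappa * s) * form w y.
Proof.
move=> w0; rewrite /form /rotation/=.
have -> : expR (2 * kappa * s) = expR (kappa * s) ^+ 2.
  by rewrite expr2 -expRD; congr expR; ring.
have CN := cos2Dsin2 s; move: (cos s) (sin s) (expR _) CN => C N E CN.
rewrite -[_ ^+ 2 + _ in RHS]mul1r -CN.
by field.
Qed.

(** [form w] vanishes only at the origin, and the flow multiplies it by a positive factor. *)
Lemma rotation_eq0 {R : realType} (w kappa s : R) (y : R * R) : w != 0 ->
  (rotation w kappa y s == 0) = (y == 0).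
Proof.
move=> w0; have formE z : (form w z == 0) = (z == 0).
  by case: z => z1 z2; rewrite /form/= -exprMn paddr_eq0 ?sqr_ge0// !sqrf_eq0 mulf_eq0 (negbTE w0).
by rewrite -formE form_rotation// mulf_eq0 gt_eqF ?expR_gt0//= formE.
Qed.

(** At jump times [ln (enorm x)] is [- (a + kappa) * T n + ln (sqnorm (Y n)) / 2]. Since [U] is
    comparable with [sqnorm], the hypothesis bounds [r * ln (sqnorm (Y n))] above by a constant,
    which disappears after division by [T n]. *)
Lemma growth_rate_le {R : realType} (a b kappa l r m M : R) (i0 : bool)
    (S : nat -> R) (iota : R -> bool) (x : R -> 'cV[R]_2) (Y : nat -> R * R)
    (U : nat -> R * R -> R) :
  b != 0 -> (forall n, 0 <= S n) ->
  \sum_(k < n) S k @[n --> \oo] --> +oo ->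
  (forall (n : nat) (t : R),
    \sum_(k < n) S k <= t < \sum_(k < n.+1) S k -> iota t = i0 (+) odd n) ->
  switched_solution (switch_mx a b) iota x -> x 0 != 0 ->
  Y 0%N = vec (x 0) ->
  (forall n, Y n.+1 = rotation (aspect b (i0 (+) odd n)) kappa (Y n) (S n)) ->
  0 < m -> (forall n y, m * sqnorm y <= U n y <= M * sqnorm y) ->
  (\forall n \near \oo, U n (Y n) `^ r < 1) ->
  (ln (enorm (x t)) / t) @[t --> +oo] --> l ->
  r * (l + a + kappa) <= 0.
Proof.
move=> b0 S0 Too iotaE sol x0 Y0 YS m0 UmM Ult1 xl.
have xE n := vec_jump_times a b kappa i0 S iota x Y b0 S0 iotaE sol Y0 YS n.
set T := fun n => \sum_(k < n) S k in Too xE.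
have Yneq0 n : 0 < sqnorm (Y n).
  rewrite lt_neqAle eq_sym sqnorm_eq0 sqnorm_ge0 andbT.
  elim: n => [|n IHn].
    rewrite Y0; apply: contra x0 => /eqP[x00 x10].
    apply/eqP/matrixP => i j; rewrite mxE (ord1 j).
    case: (unliftP ord0 i) => [k ->|->//]; rewrite (ord1 k).
    by have -> : lift ord0 0 = 1 :> 'I_2 by exact/val_inj.
  by rewrite YS rotation_eq0//; rewrite /aspect; case: ifP => _; rewrite ?invr_eq0.
have lnE n : ln (enorm (x (T n))) = - (a + kappa) * T n + ln (sqnorm (Y n)) / 2.
  have -> : enorm (x (T n)) = expR (- (a + kappa) * T n) * Num.sqrt (sqnorm (Y n)).
    rewrite sqnorm_vec xE.
    have -> : forall c, sqnorm (c * (Y n).1, c * (Y n).2) = c ^+ 2 * sqnorm (Y n).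
      by move=> c; rewrite /sqnorm/=; ring.
    by rewrite sqrtrM ?sqr_ge0// sqrtr_sqr ger0_norm ?expR_ge0.
  rewrite lnM ?posrE ?expR_gt0 ?sqrtr_gt0// expRK; congr (_ + _).
  by rewrite -powR12_sqrt ?ltW// ln_powR mulrC.
have lim1 : 2 * r * (ln (enorm (x (T n))) / T n + (a + kappa)) @[n --> \oo]
    --> 2 * r * (l + (a + kappa)).
  apply: cvgM; first exact: cvg_cst.
  apply: cvgD; last exact: cvg_cst.
  exact: (cvg_comp _ _ Too xl).
pose C := `|r| * (`|ln m| + `|ln M|).
have lim2 : C * (T n)^-1 @[n --> \oo] --> 0.
  rewrite -(mulr0 C); apply: cvgM; first exact: cvg_cst.
  apply/gtr0_cvgV0 => //; exact: cvgry_gt.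
suff : 2 * r * (l + (a + kappa)) <= 0 by rewrite addrA; lra.
apply: (ler_cvg_to lim1 lim2).
near=> n.
have Tn : 0 < T n by near: n; exact: cvgry_gt.
have Un : U n (Y n) `^ r < 1 by near: n.
rewrite lnE.
have /andP[Um UM] := UmM n (Y n).
have UY : 0 < U n (Y n) by apply: lt_le_trans Um; rewrite mulr_gt0.
have M0 : 0 < M by rewrite -(pmulr_lgt0 _ (Yneq0 n)); exact: lt_le_trans UM.
have h1 : r * ln (U n (Y n)) < 0 by rewrite -ln_powR ln_lt0// Un powR_gt0.
have h2 : ln m + ln (sqnorm (Y n)) <= ln (U n (Y n)).
  by rewrite -lnM ?posrE// ler_ln ?posrE// mulr_gt0.
have h3 : ln (U n (Y n)) <= ln M + ln (sqnorm (Y n)).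
  by rewrite -lnM ?posrE// ler_ln ?posrE// mulr_gt0.
have -> : 2 * r * ((- (a + kappa) * T n + ln (sqnorm (Y n)) / 2) / T n + (a + kappa))
  = r * ln (sqnorm (Y n)) / T n by field; rewrite gt_eqF.
rewrite ler_pM2r ?invr_gt0//.
have h4 : `|ln (U n (Y n)) - ln (sqnorm (Y n))| <= `|ln m| + `|ln M|.
  have := ler_norm (ln M); have := ler_norm (- ln m); rewrite normrN => ? ?.
  rewrite ler_norml; apply/andP; split; have := normr_ge0 (ln M); have := normr_ge0 (ln m); lra.
have : - (r * (ln (U n (Y n)) - ln (sqnorm (Y n)))) <= C.
  rewrite (le_trans (ler_norm _))// normrN normrM ler_wpM2l//.
lra.
Unshelve. all: by end_near. Qed.

(** * Bounds on the Lyapunov exponent *)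

Lemma exponential_probability {R : realType} (r : R) : 0 < r ->
  exists e : probability (measurableTypeR R) R,
    (e : set R -> \bar R) = exponential_prob r.
Proof.
move=> r0.
by exists (exponential_distribution_exponential_prob__canonical__probability_measure_Probability r0).
Qed.

Lemma measurable_rotation {R : realType} (w kappa : R) :
  measurable_fun setT (fun z : (R * R) * measurableTypeR R =>
    rotation w kappa z.1 z.2).
Proof.
have m1 : measurable_fun setT (fun z : (R * R) * measurableTypeR R => z.1.1).
  exact: (measurableT_comp measurable_fst measurable_fst).
have m2 : measurable_fun setT (fun z : (R * R) * measurableTypeR R => z.1.2).
  exact: (measurableT_comp measurable_snd measurable_fst).
have ms (f : R -> R) : continuous f ->
    measurable_fun setT (fun z : (R * R) * measurableTypeR R => (f z.2 : R)).
  move=> cf; have mf : measurable_fun setT (f : measurableTypeR R -> R).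
    exact: continuous_measurable_fun.
  exact: (measurableT_comp mf measurable_snd).
have mc := ms _ (@continuous_cos R).
have mn := ms _ (@continuous_sin R).
have me : measurable_fun setT (fun z : (R * R) * measurableTypeR R => expR (kappa * z.2)).
  apply: (ms (fun s => expR (kappa * s))).
  exact: (is_derive_continuous _ _ (fun x => is_derive_expRM x kappa)).
apply: measurable_fun_pair; apply: measurable_funM => //.
  by apply: measurable_funD; apply: measurable_funM => //; exact: measurable_funM.
by apply: measurable_funB; apply: measurable_funM => //; exact: measurable_funM.
Qed.

Lemma switch_rate_gt0 {R : realType} (beta u : R) i : 0 < beta -> 0 < u < 1 ->
  0 < switch_rate beta u i.
Proof.
by move=> beta0 /andP[u0 u1]; case: i; rewrite /switch_rate mulr_gt0// subr_gt0.
Qed.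

(** On the event of a starting state with positive probability, the recursion is eventually small
    and the trajectory bound applies almost surely. As [l] is deterministic, failure of the bound
    would make that event negligible. *)
Lemma lyapunov_exponent_le {R : realType} (a b beta u l kappa r rho m M : R)
    (U : bool -> R * R -> R) :
  0 < b -> 0 < beta -> 0 < u < 1 -> is_lyapunov_exponent a b beta u l ->
  (forall i, measurable_fun setT (U i)) -> 0 < m ->
  (forall i y, m * sqnorm y <= U i y <= M * sqnorm y) ->
  r != 0 -> 0 <= rho < 1 ->
  (forall i y (e : probability (measurableTypeR R) R),
    (e : set R -> \bar R) = exponential_prob (switch_rate beta u i) -> y != 0 ->
    (\int[e]_s (U (~~ i) (rotation (aspect b i) kappa y s) `^ r)%:E <=
      (rho * U i y `^ r)%:E)%E) ->
  r * (l + a + kappa) <= 0.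
Proof.
move=> b0 beta0 u01 [d [T [P [I [X [x0 [[S [mI mS indep path]] x00 sol lim]]]]]]].
move=> mU m0 UmM r0 rho01 step.
have aspect0 i : aspect b i != 0.
  by rewrite /aspect; case: i; rewrite ?invr_eq0 gt_eqF.
have mIi i : measurable (I 0 @^-1` [set i]).
  by rewrite -[X in measurable X]setTI; exact: mI.
have [i Pi] : exists i, P (I 0 @^-1` [set i]) != 0%E.
  have [P1|?] := eqVneq (P (I 0 @^-1` [set true])) 0%E; last by exists true.
  exists false; apply/eqP => P2.
  have := @probability_setT _ _ _ P.
  have -> : [set: T] = I 0 @^-1` [set true] `|` I 0 @^-1` [set false].
    by apply/seteqP; split => w //= _; case: (I 0 w); [left|right].
  rewrite measureU//; last by apply/seteqP; split => w //= -[->].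
  by rewrite [X in (X + _)%E]P1 [X in (_ + X)%E]P2 adde0 => /eqP; rewrite eq_sym onee_eq0.
set D := I 0 @^-1` [set i] in Pi.
have mD : measurable D by exact: mIi.
pose e n : probability (measurableTypeR R) R :=
  sval (cid (exponential_probability _
    (switch_rate_gt0 beta u (i (+) odd n) beta0 u01))).
have eE n : (e n : set R -> \bar R) = exponential_prob (switch_rate beta u (i (+) odd n)).
  by rewrite /e; case: cid.
pose phi n (z : (R * R) * measurableTypeR R) := rotation (aspect b (i (+) odd n)) kappa z.1 z.2.
pose V n y := U (i (+) odd n) y `^ r.
have mS' n : measurable_fun setT (S n : T -> measurableTypeR R) by exact: mS.
have U0 j : U j 0 = 0.
  have := UmM j 0.
  have -> : sqnorm (0 : R * R) = 0 by apply/eqP; rewrite sqnorm_eq0.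
  by rewrite !mulr0 -eq_le => /eqP.
have chain_lt1 := chain_eventually_lt1 P D
  (S : nat -> T -> measurableTypeR R) e phi (vec x0) V rho mD mS'.
have V_lt1 : {ae P, forall w, D w ->
    \forall n \near \oo, V n (chain (S : nat -> T -> measurableTypeR R) phi (vec x0) n w) < 1}.
  apply: chain_lt1 => //.
  - by move=> n; exact: measurable_rotation.
  - move=> n B mB; rewrite [LHS]indep//; congr (_ * _)%E.
    by apply: eq_bigr => k _; rewrite (congr1 (@^~ (B k)) (eE k)).
  - by move=> n; apply: (measurableT_comp (measurable_powR _)); exact: mU.
  - by move=> n y; exact: powR_ge0.
  - move=> n y; rewrite /V /phi /= addbN.
    (* At the origin, which the flow fixes, both sides vanish: [powR 0 r] is 0 for every [r != 0],
       negative ones included. *)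
    have [->|y0] := eqVneq y 0; last exact: step.
    have rot0 s : rotation (aspect b (i (+) odd n)) kappa (0 : R * R) s = 0.
      by apply/eqP; rewrite rotation_eq0.
    by under eq_integral do rewrite rot0 U0 powR0//; rewrite integral0 U0 powR0// mulr0.
have S_ge0 : {ae P, forall w, D w -> forall n, 0 <= S n w}.
  have /ae_foralln : forall n, {ae P, forall w, D w -> 0 <= S n w}; last first.
    by apply: filterS => w H Dw n; exact: H.
  (* The joint law is used with a constraint on the [n]-th sojourn alone; an exponential law gives
     no mass to the negative half-line. *)
  move=> n; pose B k : set R := if k == n then `]-oo, 0[%classic else setT.
  have mB k : measurable (B k) by rewrite /B; case: ifP.
  exists (D `&` \bigcap_(k in `I_n.+1) (S k @^-1` B k)); split.
  - apply: measurableI => //; apply: bigcap_measurableType => k _.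
    by rewrite -[X in measurable X]setTI; exact: mS.
  - rewrite [LHS]indep// big_ord_recr/= /B eqxx [X in (_ * (_ * X))%E](_ : _ = 0%E) ?mule0//.
    rewrite (congr1 (@^~ `]-oo, 0[%classic) (esym (eE n))) eE /exponential_prob.
    rewrite integral0_eq// => s /=; rewrite in_itv/= => s0.
    by rewrite lt0_exponential_pdf.
  - move=> w /= /not_implyP[Dw Sw]; split => // k /= _.
    rewrite /B; case: eqP => // ->; rewrite /= in_itv/= ltNge; exact/negP.
rewrite leNgt; apply/negP => contra.
have : P.-negligible D.
  have : {ae P, forall w, ~ D w}; last first.
    rewrite /almost_everywhere/=; congr (P.-negligible _).
    by apply/seteqP; split => w /=; rewrite notK.
  have FP := ae_filter_ringOfSetsType P.
  have F := @filterI _ _ FP _ _ V_lt1 (@filterI _ _ FP _ _ S_ge0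
    (@filterI _ _ FP _ _ path (@filterI _ _ FP _ _ sol lim))).
  apply: (@filterS _ _ FP _ _ _ F) => w [/= h1 [h2 [[h3 h4] [[h5 h6] h7]]]] Dw.
  move: contra; apply/negP; rewrite -leNgt.
  apply: (growth_rate_le a b kappa l r m M i (S ^~ w) (I ^~ w) (X ^~ w)
    (fun n => chain S phi (vec x0) n w) (fun n => U (i (+) odd n))) => //.
  - by rewrite gt_eqF.
  - exact: h2.
  - by move=> n t /h4 ->; rewrite (_ : I 0 w = i).
  - by rewrite h5.
  - by rewrite /= h5.
  - exact: h1.
by move/(negligibleP _ mD).1 => D0; move: Pi; rewrite D0 eqxx.
Qed.

(** * Quadratic forms along the flow and the supersolution criterion *)

Lemma is_derive_rotation {R : realType} (w kappa : R) (y : R * R) (s : R) : w != 0 ->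
  is_derive s (1 : R) (fun s => (rotation w kappa y s).1)
    (kappa * (rotation w kappa y s).1 + w * (rotation w kappa y s).2) /\
  is_derive s (1 : R) (fun s => (rotation w kappa y s).2)
    (kappa * (rotation w kappa y s).2 - w^-1 * (rotation w kappa y s).1).
Proof.
move=> w0; rewrite /rotation/=; split.
- apply: (is_derive_eq (is_derive_mul _ _ _ _ _ (is_derive_expRM s kappa)
    (is_derive_add _ _ _ _ _
      (is_derive_mul _ _ _ _ _ (is_derive_cos s) (is_derive_cst y.1 s (1 : R)))
      (is_derive_mul _ _ _ _ _ (is_derive_scale _ _ _ w (is_derive_sin s))
        (is_derive_cst y.2 s (1 : R)))))).
  by field.
- apply: (is_derive_eq (is_derive_mul _ _ _ _ _ (is_derive_expRM s kappa)
    (is_derive_sub _ _ _ _ _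
      (is_derive_mul _ _ _ _ _ (is_derive_cos s) (is_derive_cst y.2 s (1 : R)))
      (is_derive_mul _ _ _ _ _ (is_derive_scale _ _ _ w^-1 (is_derive_sin s))
        (is_derive_cst y.1 s (1 : R)))))).
  by field.
Qed.

Definition quad {R : realType} (alpha gamma delta : R) (y : R * R) : R :=
  alpha * y.1 ^+ 2 + 2 * gamma * (y.1 * y.2) + delta * y.2 ^+ 2.

(* Derivative of quad along x' = w y, y' = - x / w. *)
Definition dquad {R : realType} (w alpha gamma delta : R) (y : R * R) : R :=
  2 * (alpha * w - delta * w^-1) * (y.1 * y.2) +
  2 * gamma * (w * y.2 ^+ 2 - w^-1 * y.1 ^+ 2).

Lemma is_derive_quad {R : realType} (w kappa alpha gamma delta : R) (y : R * R) (s : R) :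
  w != 0 ->
  is_derive s (1 : R) (fun s => quad alpha gamma delta (rotation w kappa y s))
    (2 * kappa * quad alpha gamma delta (rotation w kappa y s) +
     dquad w alpha gamma delta (rotation w kappa y s)).
Proof.
move=> w0; have [d1 d2] := is_derive_rotation w kappa y s w0.
rewrite /quad; apply: (is_derive_eq (is_derive_add _ _ _ _ _
  (is_derive_add _ _ _ _ _
    (is_derive_scale _ _ _ alpha (is_derive_sqr _ _ _ d1))
    (is_derive_scale _ _ _ (2 * gamma) (is_derive_mul _ _ _ _ _ d1 d2)))
  (is_derive_scale _ _ _ delta (is_derive_sqr _ _ _ d2)))).
by rewrite /dquad; ring.
Qed.

Lemma measurable_quad {R : realType} (alpha gamma delta : R) :
  measurable_fun setT (quad alpha gamma delta).
Proof.
have m1 : measurable_fun setT (@fst R R) := measurable_fst.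
have m2 : measurable_fun setT (@snd R R) := measurable_snd.
apply: measurable_funD; first apply: measurable_funD.
- by apply: measurable_funM => //; exact: measurable_funX.
- by apply: measurable_funM => //; exact: measurable_funM.
- by apply: measurable_funM => //; exact: measurable_funX.
Qed.

Lemma aspect_neq0 {R : realType} (b : R) i : 0 < b -> aspect b i != 0.
Proof. by move=> b0; case: i; rewrite /= ?invr_eq0 gt_eqF. Qed.

(* Phi i is a supersolution of the renewal equation of the chain: its value bounds
   the mean of (U (~~ i)) `^ r at the end of a sojourn in state i. *)
Lemma lyapunov_criterion {R : realType} (a b beta u l kappa r rho m M : R)
    (alpha gamma delta : bool -> R) (Phi dPhi : bool -> R * R -> R)
    (U := fun i => quad (alpha i) (gamma i) (delta i)) :
  0 < b -> 0 < beta -> 0 < u < 1 -> is_lyapunov_exponent a b beta u l ->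
  0 < m -> (forall i y, m * sqnorm y <= U i y <= M * sqnorm y) ->
  r != 0 -> 0 <= rho < 1 ->
  (forall i y s, y != 0 -> is_derive s (1 : R)
    (fun s => Phi i (rotation (aspect b i) kappa y s))
    (dPhi i (rotation (aspect b i) kappa y s))) ->
  (forall i y, y != 0 -> 0 <= Phi i y <= rho * U i y `^ r) ->
  (forall i y, y != 0 ->
    dPhi i y <= switch_rate beta u i * (Phi i y - U (~~ i) y `^ r)) ->
  r * (l + a + kappa) <= 0.
Proof.
move=> b0 beta0 u01 lya m0 UmM r0 rho01 PhiD Phi01 dPhi_le.
apply: (lyapunov_exponent_le a b beta u l kappa r rho m M U) => //.
  by move=> i; exact: measurable_quad.
move=> i y e eE y0.
have w0 := aspect_neq0 b i b0.
have roty0 s : rotation (aspect b i) kappa y s != 0 by rewrite rotation_eq0.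
have Upos j s : 0 < U j (rotation (aspect b i) kappa y s).
  have /andP[+ _] := UmM j (rotation (aspect b i) kappa y s).
  by apply: lt_le_trans; rewrite mulr_gt0// lt_neqAle sqnorm_ge0 eq_sym sqnorm_eq0 roty0.
(* [Phi i] along the flow started at [y] is the supersolution; its value at time 0 bounds the
   mean. *)
apply: (@le_trans _ _ (Phi i (rotation (aspect b i) kappa y 0))%:E).
  apply: (integral_exponential_le (switch_rate beta u i) _
    (fun s => Phi i (rotation (aspect b i) kappa y s))
    (fun s => dPhi i (rotation (aspect b i) kappa y s))) => //.
  - exact: switch_rate_gt0.
  - pose z s := rotation (aspect b i) kappa y s.
    pose dU s := 2 * kappa * U (~~ i) (z s) +
      dquad (aspect b i) (alpha (~~ i)) (gamma (~~ i)) (delta (~~ i)) (z s).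
    apply: (is_derive_continuous _ (fun s => r * U (~~ i) (z s) `^ (r - 1) * dU s)) => s.
    by apply: is_derive_powR_comp; [exact: Upos|exact: is_derive_quad].
  - by move=> s; exact: powR_ge0.
  - by move=> s; have /andP[] := Phi01 i _ (roty0 s).
  - by move=> s; exact: PhiD.
  - by move=> s _; exact: dPhi_le.
have -> : rotation (aspect b i) kappa y 0 = y.
  by rewrite /rotation mulr0 expR0 cos0 sin0 !mulr0 !mul0r !mul1r addr0 subr0; case: y {y0 roty0 Upos}.
by rewrite lee_fin; have /andP[] := Phi01 i y y0.
Qed.

(** * Slow switching *)

Lemma switch_rate_le {R : realType} (beta u : R) i : 0 < beta -> 0 < u < 1 ->
  switch_rate beta u i <= beta.
Proof. by move=> beta0 u01; case: i; rewrite /switch_rate; nra. Qed.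

(** Inversion reverses inequalities: [r = 1] rests on the first comparison, [r = -1] on the
    second. *)
Lemma ler_powR_pm1 {R : realType} (r x y K : R) : r = 1 \/ r = -1 ->
  0 < x -> 0 < y -> x <= K * y -> y <= K * x -> x `^ r <= K * y `^ r.
Proof.
move=> [->|->] x0 y0 xy yx; first by rewrite (powRr1 (ltW x0)) (powRr1 (ltW y0)).
by rewrite (powR_inv1 (ltW x0)) (powR_inv1 (ltW y0)) ler_pdivlMr// mulrC ler_pdivrMr.
Qed.

(** Each [U i] is conserved by its own flow without scalar part, and [U (~~ i) <= K * U i] because
    the ratio of the coefficients [w i ^+ 2] is [b ^+ 4] or [b ^- 4]. So half of the [r]-th power of
    [U i], damped at rate of order [beta * K], is a supersolution. *)
Lemma lyapunov_slow_switching {R : realType} (a b beta u l : R) :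
  0 < b -> 0 < beta -> 0 < u < 1 -> is_lyapunov_exponent a b beta u l ->
  `|l + a| <= beta * (b ^+ 2 ^+ 2 + b ^- 2 ^+ 2).
Proof.
move=> b0 beta0 u01 lya; set K := b ^+ 2 ^+ 2 + b ^- 2 ^+ 2.
pose w i := aspect b i.
pose U i : R * R -> R := quad 1 0 (w i ^+ 2).
have c0 : 0 < b ^+ 2 by rewrite exprn_gt0.
have cV : 0 < b ^- 2 by rewrite invr_gt0.
have w2 i : w i ^+ 2 = if i then b ^- 2 else b ^+ 2.
  by case: i; rewrite /w/= ?exprVn.
have cd : b ^+ 2 * b ^- 2 = 1 by rewrite divff// gt_eqF.
have K1 : 1 <= K by rewrite /K; move: (b ^+ 2) (b ^- 2) cd => c e; nra.
have wK i : w (~~ i) ^+ 2 <= K * w i ^+ 2.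
  by case: i; rewrite !w2 /K /=; move: (b ^+ 2) (b ^- 2) c0 cV cd => c e c0 e0 ce;
    rewrite mulrDl; nra.
have wM i : w i ^+ 2 <= 1 + K.
  by case: i; rewrite w2 /K; move: (b ^+ 2) (b ^- 2) => c e; nra.
have wm i : 1 <= (1 + K) * w i ^+ 2.
  by have := wM (~~ i); case: i; rewrite !w2 /=;
    move: (b ^+ 2) (b ^- 2) c0 cV cd => c e c0 e0 ce; nra.
have UmM i y : (1 + K)^-1 * sqnorm y <= U i y <= (1 + K) * sqnorm y.
  have y1 := sqr_ge0 y.1; have y2 := sqr_ge0 y.2.
  rewrite /U /quad /sqnorm; have h1 := wM i; have h2 := wm i; apply/andP; split.
    by rewrite ler_pdivrMl; [nra|lra].
  by nra.
have U_gt0 i y : y != 0 -> 0 < U i y.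
  move=> y0; have /andP[+ _] := UmM i y; apply: lt_le_trans.
  rewrite mulr_gt0//; first by rewrite invr_gt0; lra.
  by rewrite lt_neqAle sqnorm_ge0 eq_sym sqnorm_eq0 y0.
have ratio i y : U (~~ i) y <= K * U i y.
  have y1 := sqr_ge0 y.1; have y2 := sqr_ge0 y.2.
  by rewrite /U /quad; have := wK i; nra.
(* [r = 1] gives the upper bound on [l + a], [r = -1] the lower one. The choice
   [kappa = - r * beta * K] makes the derivative of the supersolution the same in both cases, as
   [r * r = 1]. *)
have bound r : r = 1 \/ r = -1 -> r * (l + a - r * (beta * K)) <= 0.
  move=> r1; have rr : r * r = 1 by case: r1 => ->; rewrite ?mulr1// mulrNN mulr1.
  have r0 : r != 0 by apply/eqP => r0; move: rr; rewrite r0 mul0r => /eqP; rewrite eq_sym oner_eq0.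
  apply: (lyapunov_criterion a b beta u l (- (r * (beta * K))) r 2^-1 (1 + K)^-1 (1 + K)
    (fun=> 1) (fun=> 0) (fun i => w i ^+ 2) (fun i y => 2^-1 * U i y `^ r)
    (fun i y => - (beta * K) * U i y `^ r)) => //.
  - by rewrite invr_gt0; lra.
  - by rewrite invr_ge0 ler0n invf_lt1// ltr1n.
  - move=> i y s y0; have w0 := aspect_neq0 b i b0.
    have roty0 : rotation (aspect b i) (- (r * (beta * K))) y s != 0 by rewrite rotation_eq0.
    have D := is_derive_quad (aspect b i) (- (r * (beta * K))) 1 0 (w i ^+ 2) y s w0.
    have E := is_derive_powR_comp
      (fun s => U i (rotation (aspect b i) (- (r * (beta * K))) y s))
      s _ r (U_gt0 i _ roty0) D.
    apply: (is_derive_eq (is_derive_scale _ _ _ 2^-1 E)).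
    rewrite /U; set q := quad _ _ _ _.
    have q0 : 0 < q by exact: U_gt0.
    rewrite powRB; last by rewrite (gt_eqF q0) implybT.
    rewrite powRr1 ?ltW// (_ : dquad _ _ _ _ _ = 0); last first.
      by rewrite /dquad /w; field.
    transitivity (- (r * r) * (beta * K) * q `^ r); last by rewrite rr mulNr mul1r.
    by field; rewrite gt_eqF.
  - by move=> i y y0; rewrite mulr_ge0 ?powR_ge0// lexx.
  - move=> i y y0; have h := ler_powR_pm1 _ _ _ _ r1 (U_gt0 (~~ i) y y0) (U_gt0 i y y0)
      (ratio i y).
    have {}h : U (~~ i) y `^ r <= K * U i y `^ r.
      by apply: h; have := ratio (~~ i) y; rewrite negbK.
    have rate0 := switch_rate_gt0 beta u i beta0 u01.
    have rate1 := switch_rate_le beta u i beta0 u01.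
    have p0 := powR_ge0 (U (~~ i) y) r; have p1 := powR_ge0 (U i y) r.
    move: h p0 p1; rewrite -/(U i) -/(U (~~ i)).
    move: (U (~~ i) y `^ r) (U i y `^ r) => p q h p0 p1.
    rewrite -subr_ge0.
    have -> : switch_rate beta u i * (2^-1 * q - p) - - (beta * K) * q =
      switch_rate beta u i * (2^-1 * q) +
      (beta - switch_rate beta u i) * p + beta * (K * q - p) by ring.
    by rewrite !addr_ge0// mulr_ge0 ?subr_ge0 ?mulr_ge0 ?invr_ge0// ltW.
have h1 := bound 1 (or_introl erefl); have h2 := bound (-1) (or_intror erefl).
by rewrite ler_norml; apply/andP; split; lra.
Qed.

(** * Fast switching *)

(** The supersolution inequality for [r = 1], divided by [rho]: [x] and [y] stand for [U i] and
    [U (~~ i)], [G] for the derivative of [x] along the flow without scalar part. The remaining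
    drift and the surplus [beta ^- 2] both cost [O(1 / beta) * q], absorbed by the damping since
    [q <= 2 * x]. *)
Lemma fast_switching_upper {R : realType} (beta lambda C q x y G : R) :
  0 < beta -> 0 <= lambda <= beta -> 0 <= C -> 0 <= q ->
  q / 2 <= x -> 0 <= y <= 2 * q ->
  G - lambda * (x - y) <= C / beta * q ->
  G - 2 * (2 * (C ^+ 2 + 2 * C + 4) / beta) * x <= lambda * (x - (1 + beta ^- 2) * y).
Proof.
move=> beta0 /andP[l0 lb] C0 q0 qx /andP[y0 yq] GC.
have e0 : 0 < beta^-1 by rewrite invr_gt0.
have le : lambda * beta ^- 2 <= beta^-1.
  by rewrite ler_pdivrMr ?exprn_gt0// expr2 mulKf ?gt_eqF.
have f0 : 0 <= lambda * beta ^- 2 by rewrite mulr_ge0// invr_ge0 exprn_ge0// ltW.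
have h1 : lambda * beta ^- 2 * y <= beta^-1 * (2 * q) by exact: (ler_pM f0 y0 le yq).
have h2 : (C ^+ 2 + 2 * C + 4) * (q / 2) <= (C ^+ 2 + 2 * C + 4) * x.
  by rewrite ler_wpM2l// !addr_ge0 ?sqr_ge0// mulr_ge0.
have h3 := ler_wpM2l (ltW e0) h2.
have h4 : 0 <= beta^-1 * q * (C ^+ 2 + C) by rewrite !mulr_ge0 ?addr_ge0 ?sqr_ge0// ltW.
have h5 : 0 <= beta^-1 * q by rewrite mulr_ge0// ltW.
move: (beta ^- 2) (beta^-1) e0 le h1 h3 h4 h5 GC => f e e0 le h1 h3 h4 h5 GC.
nra.
Qed.

(** The supersolution inequality for [r = -1], multiplied by [x ^+ 2 * y / rho]. Splitting
    [x ^+ 2 - x * y] as [(x - y) ^+ 2 + (x - y) * y] adds a term of size [C ^+ 2]; the drift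
    contributes [2 * C] and the surplus [4], whence the constant. *)
Lemma fast_switching_lower {R : realType} (beta lambda C q x y G : R) :
  0 < beta -> 0 <= lambda <= beta -> 0 <= C -> 0 <= q ->
  q / 2 <= x <= 2 * q -> q / 2 <= y <= 2 * q ->
  `|x - y| <= C / beta * q -> - (C / beta * q) <= G - lambda * (x - y) ->
  lambda * ((1 + beta ^- 2) * x ^+ 2 - x * y) - G * y <=
    2 * (2 * (C ^+ 2 + 2 * C + 4) / beta) * (x * y).
Proof.
move=> beta0 /andP[l0 lb] C0 q0 /andP[qx xq] /andP[qy yq] xyC GC.
have e0 : 0 < beta^-1 by rewrite invr_gt0.
have x0 : 0 <= x by lra.
have y0 : 0 <= y by lra.
have le : lambda * beta ^- 2 <= beta^-1.
  by rewrite ler_pdivrMr ?exprn_gt0// expr2 mulKf ?gt_eqF.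
have h1 : lambda * beta ^- 2 * x ^+ 2 <= beta^-1 * (4 * q ^+ 2).
  have f0 : 0 <= lambda * beta ^- 2 by rewrite mulr_ge0// invr_ge0 exprn_ge0// ltW.
  by apply: (ler_pM f0 (sqr_ge0 x) le); nra.
have h2 : lambda * (x - y) ^+ 2 <= beta^-1 * (C ^+ 2 * q ^+ 2).
  have : (x - y) ^+ 2 <= (C / beta * q) ^+ 2.
    by rewrite -[leLHS]real_normK ?num_real// ler_sqr ?nnegrE ?normr_ge0// !mulr_ge0// ltW.
  move=> /(ler_wpM2l l0) /le_trans; apply.
  have -> : lambda * (C / beta * q) ^+ 2 = lambda * beta ^- 2 * (C ^+ 2 * q ^+ 2)
    by field; rewrite gt_eqF.
  by rewrite ler_wpM2r// mulr_ge0 ?sqr_ge0.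
have h3 : - (G - lambda * (x - y)) * y <= C / beta * q * (2 * q).
  have := ler_wpM2r y0 GC.
  have : C / beta * q * y <= C / beta * q * (2 * q).
    by rewrite ler_wpM2l// !mulr_ge0// ltW.
  by rewrite !mulNr; lra.
have h4 : q ^+ 2 / 4 <= x * y.
  have := @ler_pM R (q / 2) x (q / 2) y; rewrite !divr_ge0// => /(_ isT isT qx qy).
  by rewrite (_ : q / 2 * (q / 2) = q ^+ 2 / 4)//; field.
have h5 : (C ^+ 2 + 2 * C + 4) * (q ^+ 2 / 4) <= (C ^+ 2 + 2 * C + 4) * (x * y).
  by rewrite ler_wpM2l// !addr_ge0 ?sqr_ge0// mulr_ge0.
have h6 := ler_wpM2l (ltW e0) h5.
have -> : lambda * ((1 + beta ^- 2) * x ^+ 2 - x * y) - G * y =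
  lambda * beta ^- 2 * x ^+ 2 + lambda * (x - y) ^+ 2 + - (G - lambda * (x - y)) * y by ring.
move: (beta ^- 2) (beta^-1) e0 le h1 h2 h3 h6 => f e e0 le h1 h2 h3 h6.
lra.
Qed.

(* U false is the quadratic form conserved by the averaged matrix; U true is
   corrected so that U false - U true solves the Poisson equation of the chain,
   which leaves a drift of order 1 / beta. *)
Lemma lyapunov_fast_switching {R : realType} (b u : R) : 0 < b -> 0 < u < 1 ->
  exists B C : R, forall a beta l : R, 0 < beta -> B <= beta ->
    is_lyapunov_exponent a b beta u l -> `|l + a| <= C / beta.
Proof.
move=> b0 u01; have /andP[u0 u1] := u01.
have v0 : 0 < 1 - u by rewrite subr_gt0.
have bV0 : 0 < b^-1 by rewrite invr_gt0.
(* The stationary law of the chain gives weights [1 - u] and [u] to states 0 and 1, so the averaged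
   matrix without scalar part is [[[0, n], [- k, 0]]], which conserves
   [k * y.1 ^+ 2 + n * y.2 ^+ 2]. *)
pose k := (1 - u) * b^-1 + u * b.
pose n := (1 - u) * b + u * b^-1.
have k0 : 0 < k by rewrite addr_gt0 ?mulr_gt0.
have n0 : 0 < n by rewrite addr_gt0 ?mulr_gt0.
pose D := b ^+ 2 - b^-1 ^+ 2.
pose q := quad k 0 n : R * R -> R.
pose L := k^-1 + n^-1.
have L0 : 0 < L by rewrite addr_gt0 ?invr_gt0.
pose C := 2 * `|D| * (1 + b + b^-1) * L.
have B0 : 0 <= 1 + b + b^-1 by lra.
have C0 : 0 <= C by rewrite !mulr_ge0// ltW.
have sqq y : sqnorm y <= L * q y.
  have y1 := sqr_ge0 y.1; have y2 := sqr_ge0 y.2.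
  rewrite /sqnorm /q /quad /L.
  have -> : (k^-1 + n^-1) * (k * y.1 ^+ 2 + 2 * 0 * (y.1 * y.2) + n * y.2 ^+ 2) =
     y.1 ^+ 2 + y.2 ^+ 2 + (n / k * y.2 ^+ 2 + k / n * y.1 ^+ 2) by field; rewrite !gt_eqF.
  by rewrite lerDl addr_ge0// mulr_ge0// divr_ge0// ltW.
(* The threshold on [beta] makes [C / beta <= 1 / 2], so the correction stays below half of [q]. *)
exists (2 * C + 1), (2 * (C ^+ 2 + 2 * C + 4)) => a beta l beta0 betaC lya.
have e0 : 0 < beta^-1 by rewrite invr_gt0.
pose gam (i : bool) := if i then - (D / beta) else 0.
pose U (i : bool) := quad k (gam i) n.
have q0 y : 0 <= q y.
  have y1 := sqr_ge0 y.1; have y2 := sqr_ge0 y.2.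
  by rewrite /q /quad; nra.
have Dq z y : `|z| <= (1 + b + b^-1) * sqnorm y -> `|2 * D * z / beta| <= C / beta * q y.
  move=> zy; rewrite normrM (gtr0_norm e0) [leRHS]mulrAC ler_pM2r// !normrM ger0_norm//.
  have -> : C * q y = 2 * `|D| * ((1 + b + b^-1) * (L * q y)) by rewrite /C; ring.
  rewrite ler_wpM2l// ?mulr_ge0//; apply: (le_trans zy).
  by rewrite ler_wpM2l.
have Dxy y : `|2 * D * (y.1 * y.2) / beta| <= C / beta * q y.
  apply: Dq; have := sqr_ge0 (y.1 + y.2); have := sqr_ge0 (y.1 - y.2).
  rewrite sqrrB sqrrD /sqnorm => h1 h2.
  have s0 := sqnorm_ge0 y; rewrite /sqnorm in s0.
  have h3 : (b + b^-1) * (y.1 ^+ 2 + y.2 ^+ 2) >= 0 by rewrite mulr_ge0// addr_ge0// ltW.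
  by rewrite ler_norml; apply/andP; split; lra.
have UU i y : `|U i y - U (~~ i) y| <= C / beta * q y.
  case: i; rewrite /U /quad /=.
    rewrite -normrN; apply: le_trans (Dxy y); rewrite le_eqVlt; apply/orP; left.
    by apply/eqP; congr `|_|; ring.
  apply: le_trans (Dxy y); rewrite le_eqVlt; apply/orP; left.
  by apply/eqP; congr `|_|; ring.
have Uq i y : `|U i y - q y| <= C / beta * q y.
  case: i; first exact: UU true y.
  by rewrite subrr normr0 mulr_ge0// divr_ge0// ltW.
have Ce : C / beta <= 2^-1.
  by rewrite ler_pdivrMr//; lra.
have U_bounds i y : q y / 2 <= U i y <= 2 * q y.
  have h := ler_wpM2r (q0 y) Ce.
  have := Uq i y; rewrite ler_norml => /andP[h1 h2].
  by have h0 := q0 y; apply/andP; split; lra.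
pose G i := dquad (aspect b i) k (gam i) n.
(* In state 0 the Poisson equation holds exactly. In state 1 the correction is itself
   differentiated, which leaves [2 * D * (b * y.1 ^+ 2 - b^-1 * y.2 ^+ 2) / beta]. *)
have GU i y : `|G i y - switch_rate beta u i * (U i y - U (~~ i) y)| <= C / beta * q y.
  have z := Dq (b * y.1 ^+ 2 - b^-1 * y.2 ^+ 2) y.
  case: i; rewrite /G /U /quad /dquad /aspect /switch_rate /gam /=; last first.
    rewrite (_ : _ - _ = 0) ?normr0; first by rewrite mulr_ge0// divr_ge0// ltW.
    by rewrite /D /k /n; field; rewrite !gt_eqF.
  apply: le_trans (z _).
    rewrite le_eqVlt; apply/orP; left; apply/eqP; congr `|_|.
    by rewrite /D /k /n; field; rewrite !gt_eqF.
  have y1 := sqr_ge0 y.1; have y2 := sqr_ge0 y.2.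
  by rewrite /sqnorm ler_norml; apply/andP; split; nra.
(* [rho] has to be below 1, but at a jump rate up to [beta] its gap to 1 may only be of order
   [beta ^- 2] for the cost to be [O(1 / beta)]. *)
pose rho := (1 + beta ^- 2)^-1.
pose eta := 2 * (C ^+ 2 + 2 * C + 4) / beta.
pose m := (2 * L)^-1.
pose M := 2 * (k + n).
have f0 : 0 < beta ^- 2 by rewrite invr_gt0 exprn_gt0.
have rho0 : 0 < rho by rewrite invr_gt0; lra.
have rho1 : rho < 1 by rewrite invf_lt1 ?ltrDl//; lra.
have UmM i y : m * sqnorm y <= U i y <= M * sqnorm y.
  have /andP[U1 U2] := U_bounds i y; apply/andP; split.
    apply: le_trans U1; rewrite /m invfM.
    have h : L^-1 * sqnorm y <= q y by rewrite ler_pdivrMl.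
    by rewrite -mulrA; lra.
  apply: (le_trans U2); rewrite /M -mulrA ler_pM2l// /q /quad /sqnorm.
  have y1 := sqr_ge0 y.1; have y2 := sqr_ge0 y.2.
  nra.
have rate0 i := switch_rate_gt0 beta u i beta0 u01.
have rate1 i := switch_rate_le beta u i beta0 u01.
have U_gt0 i y : y != 0 -> 0 < U i y.
  move=> y0; have /andP[+ _] := UmM i y; apply: lt_le_trans.
  rewrite mulr_gt0//; first by rewrite invr_gt0 mulr_gt0.
  by rewrite lt_neqAle sqnorm_ge0 eq_sym sqnorm_eq0 y0.
have bound r : r = 1 \/ r = -1 -> r * (l + a - r * eta) <= 0.
  move=> r1; have rr : r * r = 1 by case: r1 => ->; rewrite ?mulr1// mulrNN mulr1.
  have r0 : r != 0 by apply/eqP => r0; move: rr; rewrite r0 mul0r => /eqP; rewrite eq_sym oner_eq0.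
  apply: (lyapunov_criterion a b beta u l (- (r * eta)) r rho m M
    (fun=> k) gam (fun=> n) (fun i y => rho * U i y `^ r)
    (fun i y => rho * (r * U i y `^ (r - 1) * (2 * - (r * eta) * U i y + G i y)))) => //.
  - by rewrite invr_gt0 mulr_gt0.
  - by rewrite ltW.
  - move=> i y s y0; have w0 := aspect_neq0 b i b0.
    have roty0 : rotation (aspect b i) (- (r * eta)) y s != 0 by rewrite rotation_eq0.
    have dU := is_derive_quad (aspect b i) (- (r * eta)) k (gam i) n y s w0.
    have E := is_derive_powR_comp (fun s => U i (rotation (aspect b i) (- (r * eta)) y s))
      s _ r (U_gt0 i _ roty0) dU.
    exact: (is_derive_scale _ _ _ rho E).
  - by move=> i y y0; rewrite mulr_ge0 ?powR_ge0 ?lexx// ltW.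
  - move=> i y y0.
    have Ui := U_gt0 i y y0; have Uj := U_gt0 (~~ i) y y0.
    have /andP[qi iq] := U_bounds i y; have /andP[qj jq] := U_bounds (~~ i) y.
    have := GU i y; rewrite ler_norml => /andP[GU1 GU2].
    have rate01 : 0 <= switch_rate beta u i <= beta by rewrite rate1 ltW.
    have rhoV : rho * (1 + beta ^- 2) = 1 by rewrite mulVf// gt_eqF//; lra.
    rewrite -/(U i) -/(U (~~ i)).
    case: r1 => ->.
      have := fast_switching_upper _ _ _ _ _ (U (~~ i) y) _ beta0 rate01 C0 (q0 y) qi _ GU2.
      rewrite (ltW Uj) jq => /(_ isT) /(ler_wpM2l (ltW rho0)).
      rewrite subrr powRr0 (powRr1 (ltW Ui)) (powRr1 (ltW Uj)) -/eta => H.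
      apply: le_trans (le_trans H _).
        by rewrite le_eqVlt; apply/orP; left; apply/eqP; ring.
      rewrite mulrCA ler_pM2l// mulrBr mulrA rhoV mul1r; lra.
    have := fast_switching_lower _ _ _ _ _ _ _ beta0 rate01 C0 (q0 y) _ _ (UU i y) GU1.
    rewrite qi iq qj jq => /(_ isT isT) H.
    have -> : U i y `^ (-1 - 1) = U i y ^- 2.
      by rewrite -opprD -(natrD _ 1 1) powR_invn// ltW.
    rewrite (powR_inv1 (ltW Ui)) (powR_inv1 (ltW Uj)).
    have -> : (U (~~ i) y)^-1 = rho * (1 + beta ^- 2) * (U (~~ i) y)^-1.
      by rewrite rhoV mul1r.
    rewrite -/eta in H; move: (U i y) (U (~~ i) y) Ui Uj H => x z x0 z0 H.
    rewrite -subr_ge0; set lhs := (X in 0 <= X).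
    have -> : lhs = rho / (x ^+ 2 * z) * (2 * eta * (x * z) -
        (switch_rate beta u i * ((1 + beta ^- 2) * x ^+ 2 - x * z) - G i y * z)).
      by rewrite /lhs; field; rewrite !gt_eqF.
    by rewrite mulr_ge0 ?subr_ge0// divr_ge0 ?mulr_ge0 ?exprn_ge0// ltW.
have h1 := bound 1 (or_introl erefl); have h2 := bound (-1) (or_intror erefl).
rewrite -/eta ler_norml; apply/andP; split; lra.
Qed.

(** * Positivity *)

(** In coordinates with [xi' = eta] and [eta' = - xi], [Q] and [P] are the fourth roots of the forms
    of the current and of the other state. [P^-1] is large compared with [Q^-1] only where [xi] is
    small; there [xi * eta] grows at a rate close to [Q ^+ 4], so its term in [Phi] supplies the
    decrease that pays for [- lambda * P^-1]. The multiple of [Q^-1] covers the rest. *)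
Lemma sojourn_supersolution {R : realType} (c lambda del xi eta P Q : R)
    (Phi := (6 + 2 * lambda) / c * Q^-1 - 2 * lambda * (xi * eta) * P^-1 / Q ^+ 4) :
  0 < P -> 0 < Q -> 0 < lambda -> 0 <= del <= lambda ->
  2 * (6 + 4 * lambda) <= c ->
  Q ^+ 4 = xi ^+ 2 + eta ^+ 2 -> P ^+ 4 = c ^+ 4 * xi ^+ 2 + c ^- 4 * eta ^+ 2 ->
  0 <= Phi <= 2^-1 * Q^-1 /\
  del / 2 * Phi - 2 * lambda * ((eta ^+ 2 - xi ^+ 2) * P^-1 -
      (c ^+ 4 - c ^- 4) / 2 * (xi * eta) ^+ 2 * P^-1 / P ^+ 4) / Q ^+ 4 <=
    lambda * (Phi - P^-1).
Proof.
move=> P0 Q0 lam0 /andP[del0 dell] clam QE PE.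
have c0 : 0 < c by lra.
have cV : 0 < c ^- 4 by rewrite invr_gt0 exprn_gt0.
have x2 := sqr_ge0 xi; have e2 := sqr_ge0 eta.
have Q2 : 0 <= Q ^+ 2 by rewrite sqr_ge0.
(* The key estimate: every quantity with a factor [xi / P] is of order [1 / c]. *)
have h1 : c * `|xi| <= P * Q.
  have A : c * `|xi| \is Num.nneg by rewrite nnegrE mulr_ge0// ltW.
  have B : P * Q \is Num.nneg by rewrite nnegrE mulr_ge0// ltW.
  rewrite -(@ler_pXn2r _ 4 isT _ _ A B).
  rewrite !exprMn QE PE (_ : `|xi| ^+ 4 = xi ^+ 2 * xi ^+ 2); last first.
    by rewrite -exprD -[4%N]/(2 * 2)%N exprM real_normK ?num_real// -exprM.
  have h0 : 0 <= c ^- 4 * eta ^+ 2 * (xi ^+ 2 + eta ^+ 2).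
    by apply: mulr_ge0; [apply: mulr_ge0 => //; exact: ltW|exact: addr_ge0].
  have h1 : 0 <= c ^+ 4 * xi ^+ 2 * eta ^+ 2.
    by apply: mulr_ge0 => //; apply: mulr_ge0 => //; rewrite exprn_ge0// ltW.
  rewrite -subr_ge0 (_ : _ - _ = c ^- 4 * eta ^+ 2 * (xi ^+ 2 + eta ^+ 2) +
    c ^+ 4 * xi ^+ 2 * eta ^+ 2); first exact: addr_ge0.
  by ring.
have Q22 : Q ^+ 2 ^+ 2 = xi ^+ 2 + eta ^+ 2 by rewrite -exprM.
have h2 : `|xi| <= Q ^+ 2.
  by rewrite -(@ler_pXn2r _ 2)// ?nnegrE// real_normK ?num_real// Q22 lerDl.
have h3 : `|eta| <= Q ^+ 2.
  by rewrite -(@ler_pXn2r _ 2)// ?nnegrE// real_normK ?num_real// Q22 lerDr.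
pose g := Q ^+ 3 / c.
have hg z : `|z| <= Q ^+ 2 -> `|xi| * `|z| / P <= g.
  move=> zQ; rewrite ler_pdivrMr//.
  have : c * `|xi| * `|z| <= P * Q * Q ^+ 2 by rewrite ler_pM// mulr_ge0// ltW.
  have -> : g * P = (P * Q * Q ^+ 2) / c by rewrite /g; field; rewrite gt_eqF.
  by rewrite ler_pdivlMr// => h; apply: le_trans h; rewrite mulrC mulrA.
pose sg := xi * eta / P.
have sgg : `|sg| <= g by rewrite /sg !normrM normfV (gtr0_norm P0); exact: hg.
pose s := xi ^+ 2 / P.
have sg' : s <= g by rewrite /s -real_normK ?num_real// expr2; exact: hg.
pose e := eta ^+ 2 / P.
pose t := (c ^+ 4 - c ^- 4) * (xi * eta) ^+ 2 * P^-1 / P ^+ 4.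
(* The derivative of [P^-1] enters through [t / 2], so it cancels at most half of the favourable
   term [e]. *)
have te : t <= e.
  have -> : t = (c ^+ 4 - c ^- 4) * xi ^+ 2 * e / P ^+ 4.
    by rewrite /t /e; field; rewrite !gt_eqF.
  have e0 : 0 <= e by rewrite divr_ge0// ltW.
  rewrite ler_pdivrMr ?exprn_gt0// mulrC ler_wpM2l// PE mulrBl.
  have : 0 <= c ^- 4 * xi ^+ 2 by rewrite mulr_ge0// ltW.
  have : 0 <= c ^- 4 * eta ^+ 2 by rewrite mulr_ge0// ltW.
  lra.
have s0 : 0 <= s by rewrite divr_ge0// ltW.
have g0 : 0 <= g := le_trans s0 sg'.
(* This is [Phi * Q ^+ 4]. The summand [2 * lambda] outweighs the product term, so [Ph >= 6 * g];
   once [del] has used at most half of [lambda * Ph], the six still pays for [3 * lambda * s].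
   Conversely [Ph <= (6 + 4 * lambda) * g], whence the threshold on [c]. *)
pose Ph := (6 + 2 * lambda) * g - 2 * lambda * sg.
have PhiE : Phi = Ph / Q ^+ 4 by rewrite /Phi /Ph /g /sg; field; rewrite !gt_eqF.
have Q4 : 0 < Q ^+ 4 by rewrite exprn_gt0.
move: sgg; rewrite ler_norml => /andP[sg1 sg2].
have l1 := ler_wpM2l (ltW lam0) sg1; have l2 := ler_wpM2l (ltW lam0) sg2.
have Ph6 : 6 * g <= Ph by rewrite /Ph; lra.
split.
  rewrite PhiE; apply/andP; split; first by apply: divr_ge0; [lra|exact: ltW].
  rewrite ler_pdivrMr// (_ : 2^-1 * Q^-1 * Q ^+ 4 = c / 2 * g); last first.
    by rewrite /g; field; rewrite !gt_eqF.
  have : (6 + 4 * lambda) * g <= c / 2 * g by rewrite ler_wpM2r//; lra.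
  by rewrite /Ph; lra.
have -> : lambda * (Phi - P^-1) = (lambda * Ph - lambda * (s + e)) / Q ^+ 4.
  have -> : s + e = Q ^+ 4 / P by rewrite QE mulrDl.
  by rewrite PhiE; field; rewrite !gt_eqF.
have -> : (eta ^+ 2 - xi ^+ 2) * P^-1 -
      (c ^+ 4 - c ^- 4) / 2 * (xi * eta) ^+ 2 * P^-1 / P ^+ 4 = e - s - t / 2.
  by rewrite /e /s /t; field; rewrite !gt_eqF.
rewrite PhiE mulrA -mulrBl ler_pM2r ?invr_gt0//.
have h4 : del / 2 * Ph <= lambda / 2 * Ph by rewrite ler_wpM2r//; lra.
have h5 := ler_wpM2l (ltW lam0) Ph6.
have h6 := ler_wpM2l (ltW lam0) te.
have h7 := ler_wpM2l (ltW lam0) sg'.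
lra.
Qed.

Lemma powR_fourth_root {R : realType} (x : R) : 0 < x -> (x `^ 4^-1) ^+ 4 = x.
Proof.
by move=> x0; rewrite -powR_mulrn ?powR_ge0// -powRrM mulVf ?pnatr_eq0// powRr1// ltW.
Qed.

(** The criterion is applied with [r = - 4^-1] and [kappa = - delta]. As [delta] is below both jump
    rates, the supersolution tolerates the growth rate [2 * r * kappa = delta / 2] that [kappa]
    gives it. *)
Lemma lyapunov_positive {R : realType} (a beta u l c : R)
    (b := c ^+ 2) (delta := beta * u * (1 - u)) :
  0 < beta -> 0 < u < 1 -> 2 * (6 + 4 * beta) <= c ->
  is_lyapunov_exponent a b beta u l -> delta <= l + a.
Proof.
move=> beta0 u01 cbeta lya; have /andP[u0 u1] := u01.
have c0 : 0 < c by lra.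
have b0 : 0 < b by rewrite exprn_gt0.
have b1 : 1 <= b ^+ 2 by rewrite /b -exprM exprn_ege1//; lra.
have delta0 : 0 < delta by rewrite !mulr_gt0// subr_gt0.
pose al (i : bool) := if i then b ^+ 2 else 1.
pose de (i : bool) := if i then 1 else b ^+ 2.
pose U i := quad (al i) 0 (de i).
pose sb (i : bool) : R := if i then - (b / 2) else b / 2.
pose Z i := quad 0 (sb i) 0 : R * R -> R.
(* Coordinates turning the flow of state [i] without scalar part into a circular rotation at unit
   speed; [U i] is then the squared radius. *)
pose xi (i : bool) (y : R * R) := if i then y.2 else y.1.
pose eta (i : bool) (y : R * R) := if i then - (b * y.1) else b * y.2.
have ZE i y : Z i y = xi i y * eta i y.
  by case: i; rewrite /Z /quad /xi /eta /sb; field.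
have UE i y : U i y = xi i y ^+ 2 + eta i y ^+ 2.
  by case: i; rewrite /U /quad /xi /eta /al /de; ring.
have UEN i y : U (~~ i) y = b ^+ 2 * xi i y ^+ 2 + b ^- 2 * eta i y ^+ 2.
  by case: i; rewrite /U /quad /xi /eta /al /de /=; field; rewrite gt_eqF.
have dUE i y : dquad (aspect b i) (al i) 0 (de i) y = 0.
  by case: i; rewrite /dquad /aspect /al /de; field; rewrite gt_eqF.
have dUNE i y : dquad (aspect b i) (al (~~ i)) 0 (de (~~ i)) y =
    2 * (b ^+ 2 - b ^- 2) * Z i y.
  by case: i; rewrite /dquad /aspect /al /de /Z /quad /sb /=; field; rewrite gt_eqF.
have dZE i y : dquad (aspect b i) 0 (sb i) 0 y = eta i y ^+ 2 - xi i y ^+ 2.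
  by case: i; rewrite /dquad /aspect /sb /eta /xi; field; rewrite gt_eqF.
have UmM i y : 1 * sqnorm y <= U i y <= b ^+ 2 * sqnorm y.
  have y1 := sqr_ge0 y.1; have y2 := sqr_ge0 y.2.
  by rewrite /U /quad /sqnorm /al /de; apply/andP; split; case: i; nra.
have U_gt0 i y : y != 0 -> 0 < U i y.
  move=> y0; have /andP[+ _] := UmM i y; apply: lt_le_trans.
  by rewrite mul1r lt_neqAle sqnorm_ge0 eq_sym sqnorm_eq0 y0.
pose lam i := switch_rate beta u i.
have lam0 i : 0 < lam i by exact: switch_rate_gt0.
have lam1 i : lam i <= beta by exact: switch_rate_le.
have dlam i : 0 <= delta <= lam i.
  have h1 := mulr_ge0 (ltW beta0) (sqr_ge0 (1 - u)).
  have h2 := mulr_ge0 (ltW beta0) (sqr_ge0 u).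
  by rewrite (ltW delta0) /delta /lam /switch_rate; case: i => /=; lra.
pose r : R := - 4^-1.
(* The supersolution above, with [Q] and [P] the fourth roots of [U i] and [U (~~ i)]; [dPhi] is its
   derivative along the flow with [kappa = - delta]. *)
pose Phi i y := (6 + 2 * lam i) / c * U i y `^ r -
  2 * lam i * (Z i y * U (~~ i) y `^ r * U i y `^ (-1)).
pose dPhi i y := delta / 2 * Phi i y - 2 * lam i *
  ((eta i y ^+ 2 - xi i y ^+ 2) * U (~~ i) y `^ r -
   (b ^+ 2 - b ^- 2) / 2 * Z i y ^+ 2 * U (~~ i) y `^ r / U (~~ i) y) / U i y.
have super i y : y != 0 -> 0 <= Phi i y <= 2^-1 * U i y `^ r /\
    dPhi i y <= lam i * (Phi i y - U (~~ i) y `^ r).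
  move=> y0; have Ui := U_gt0 i y y0; have Uj := U_gt0 (~~ i) y y0.
  have Q4 := powR_fourth_root _ Ui; have P4 := powR_fourth_root _ Uj.
  have c4 : c ^+ 4 = b ^+ 2 by rewrite /b -exprM.
  have := sojourn_supersolution c (lam i) delta (xi i y) (eta i y)
    (U (~~ i) y `^ 4^-1) (U i y `^ 4^-1).
  rewrite !powR_gt0// Q4 P4 c4 UEN UE -!ZE => /(_ isT isT (lam0 i) (dlam i)).
  rewrite /dPhi /Phi /r (powR_inv1 (ltW Ui)) !powRN UEN UE !mulrA.
  have cl : 2 * (6 + 4 * lam i) <= c by have := lam1 i; lra.
  by move=> /(_ cl erefl erefl).
suff : r * (l + a + - delta) <= 0 by rewrite /r; lra.
apply: (lyapunov_criterion a b beta u l (- delta) r 2^-1 1 (b ^+ 2)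
  al (fun=> 0) de Phi dPhi b0 beta0 u01 lya ltr01 UmM).
- by rewrite oppr_eq0 invr_eq0 pnatr_eq0.
- by rewrite invr_ge0 ler0n invf_lt1// ltr1n.
- move=> i y s y0; have w0 := aspect_neq0 b i b0.
  have roty0 : rotation (aspect b i) (- delta) y s != 0 by rewrite rotation_eq0.
  have dU := is_derive_quad (aspect b i) (- delta) (al i) 0 (de i) y s w0.
  have dUN := is_derive_quad (aspect b i) (- delta) (al (~~ i)) 0 (de (~~ i)) y s w0.
  have dZ := is_derive_quad (aspect b i) (- delta) 0 (sb i) 0 y s w0.
  have E1 := is_derive_powR_comp (fun s => U i (rotation (aspect b i) (- delta) y s))
    s _ r (U_gt0 i _ roty0) dU.
  have E2 := is_derive_powR_comp (fun s => U i (rotation (aspect b i) (- delta) y s))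
    s _ (-1) (U_gt0 i _ roty0) dU.
  have E3 := is_derive_powR_comp (fun s => U (~~ i) (rotation (aspect b i) (- delta) y s))
    s _ r (U_gt0 (~~ i) _ roty0) dUN.
  apply: (is_derive_eq (is_derive_sub _ _ _ _ _
    (is_derive_scale _ _ _ ((6 + 2 * lam i) / c) E1)
    (is_derive_scale _ _ _ (2 * lam i)
      (is_derive_mul _ _ _ _ _ (is_derive_mul _ _ _ _ _ dZ E3) E2)))).
  move: (rotation _ _ _ _) roty0 => z z0.
  have Ui := U_gt0 i z z0; have Uj := U_gt0 (~~ i) z z0.
  rewrite -/(U i z) -/(U (~~ i) z) -/(Z i z) dUE dUNE dZE /dPhi /Phi.
  have p1 x p : 0 < x -> x `^ (p - 1) = x `^ p / x.
    by move=> x0; rewrite powRB ?powRr1 ?(ltW x0)// (gt_eqF x0) implybT.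
  rewrite !p1// (powR_inv1 (ltW Ui)).
  move: (U i z) (U (~~ i) z) (Z i z) Ui Uj => X N W X0 N0.
  move: (X `^ r) (N `^ r) => Xr Nr; rewrite /r.
  by field; rewrite !gt_eqF.
- by move=> i y y0; have [] := super i y y0.
- by move=> i y y0; have [] := super i y y0.
Qed.

Theorem theorem1p1 (R : realType) (u : R) (u_gt0 : 0 < u) (u_lt1 : u < 1)
  (chi : R -> R -> R -> R -> R)
  (chiP : forall a b beta : R, 0 < a -> 0 < b -> 0 < beta ->
     is_lyapunov_exponent a b beta u (chi a b beta u)) :
  (forall a b : R, 0 < a -> 0 < b ->
     (chi a b beta u @[beta --> 0^'+] --> - a) /\
     (chi a b beta u @[beta --> +oo] --> - a)) /\
  (forall beta : R, 0 < beta ->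
     exists a b : R, [/\ 0 < a, 0 < b & 0 < chi a b beta u]).
Proof.
have u01 : 0 < u < 1 by rewrite u_gt0.
split=> [a b a0 b0|beta beta0].
  have K0 : 0 < b ^+ 2 ^+ 2 + b ^- 2 ^+ 2.
    by rewrite addr_gt0// exprn_gt0// ?invr_gt0 exprn_gt0.
  have [B [C fast]] := lyapunov_fast_switching b u b0 u01.
  split; apply/cvgrPdist_le => e e0; near=> beta; rewrite distrC opprK.
    have beta0 : 0 < beta by near: beta; exact: nbhs_right_gt.
    apply: le_trans (lyapunov_slow_switching _ _ _ _ _ b0 beta0 u01 (chiP _ _ _ a0 b0 beta0)) _.
    rewrite -ler_pdivlMr//.
    by near: beta; apply: nbhs_right_le; apply: divr_gt0.
  have beta0 : 0 < beta by near: beta; exact: nbhs_pinfty_gt.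
  have betaC : C / e <= beta by near: beta; apply: nbhs_pinfty_ge; exact: num_real.
  apply: le_trans (fast a beta _ beta0 _ (chiP _ _ _ a0 b0 beta0)) _.
    by near: beta; apply: nbhs_pinfty_ge; exact: num_real.
  by rewrite ler_pdivrMr// mulrC -ler_pdivrMr.
(* The smallest [c] allowed by [lyapunov_positive]. With [b = c ^+ 2] it gives [delta <= chi + a],
   so [a = delta / 2] leaves a positive exponent. *)
pose c : R := 2 * (6 + 4 * beta).
pose delta := beta * u * (1 - u).
have delta0 : 0 < delta by rewrite !mulr_gt0// subr_gt0.
have b0 : 0 < c ^+ 2 by rewrite exprn_gt0// /c; lra.
have a0 : 0 < delta / 2 by rewrite divr_gt0.
exists (delta / 2), (c ^+ 2); split => //.
have := lyapunov_positive _ beta u _ c beta0 u01 (lexx _) (chiP _ _ _ a0 b0 beta0).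
rewrite -/delta; lra.
Unshelve. all: by end_near.
Qed.
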